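(* Let $\eta>0$ and let $H$ be a graph with at least one edge and chromatic number $\chi(H)=r$ (so $r\ge2$). Let $h:=|H|$, $\sigma:=\sigma(H)$ and $\omega:=(h-\sigma)/(r-1)$. Then there exists $n_0=n_0(\eta,H)\in\mathbb{N}$ such that the following holds: if $G$ is a graph on $n\ge n_0$ vertices with degree sequence $d_1\le d_2\le\dots\le d_n$ such that \[d_i\ge\left(1-\frac{\omega+\sigma}{h}\right)n+\frac{\sigma}{\omega}i+\eta n\quad\text{for all } 1\le i\le\frac{\omega n}{h},\] then $G$ has an $H$-tiling covering all but at most $\eta n$ vertices.
   Context: For a graph $H$, $\sigma(H)$ denotes the smallest possible size of a colour class over all proper colourings of $H$ with $\chi(H)$ colours. An $H$-tiling in $G$ is a collection of vertex-disjoint copies of $H$ in $G$. The degree sequence is the list of vertex degrees in non-decreasing order. *)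

(* Defs.v *)
From mathcomp Require Import all_boot.

Set Implicit Arguments.
Unset Strict Implicit.
Unset Printing Implicit Defensive.

Record sgraph := SGraph {
  vertex :> finType;
  adj : rel vertex;
  adj_sym : symmetric adj;
  adj_irr : irreflexive adj }.

Definition degree (G : sgraph) (x : G) : nat := #|[set y : G | adj x y]|.

Definition degree_seq (G : sgraph) : seq nat :=
  sort leq [seq degree x | x <- enum (vertex G)].

(* The entries d_1 <= ... <= d_n are indexed from 1. *)
Definition nth_degree (G : sgraph) (i : nat) : nat := nth 0 (degree_seq G) i.-1.

Definition proper_coloring (G : sgraph) (k : nat) (f : {ffun G -> 'I_k}) : bool :=
  [forall x : G, forall y : G, adj x y ==> (f x != f y)].

Definition colorable (G : sgraph) (k : nat) : bool :=
  [exists f : {ffun G -> 'I_k}, proper_coloring f].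

Lemma ex_colorable (G : sgraph) : exists k, colorable G k.
Proof.
exists #|vertex G|; apply/existsP; exists [ffun x => enum_rank x].
apply/forallP => x; apply/forallP => y; apply/implyP => xy; rewrite !ffunE.
by apply/eqP => /enum_rank_inj exy; move: xy; rewrite exy adj_irr.
Qed.

Definition chromatic_number (G : sgraph) : nat := ex_minn (ex_colorable G).

Definition color_class (G : sgraph) (k : nat) (f : {ffun G -> 'I_k}) (c : 'I_k) :
  {set G} := [set x | f x == c].

(* The default value #|G| bounds the size of every colour class, so for a
   nonempty graph this is the minimum over all pairs (f, c). *)
Definition sigma (G : sgraph) : nat :=
  \big[minn/#|vertex G|]_(f : {ffun G -> 'I_(chromatic_number G)}
                          | proper_coloring f)
    \big[minn/#|vertex G|]_(c < chromatic_number G) #|color_class f c|.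

(* A copy of H in G is given by an embedding of H onto it. The image of H need
   not be an induced subgraph of G. *)
Definition embedding (H G : sgraph) (f : {ffun H -> G}) : bool :=
  injectiveb f && [forall x : H, forall y : H, adj x y ==> adj (f x) (f y)].

Definition copy_vertices (H G : sgraph) (f : {ffun H -> G}) : {set G} :=
  [set f x | x : H].

Definition is_tiling (H G : sgraph) (T : {set {ffun H -> G}}) : Prop :=
  {in T, forall f, embedding f} /\
  {in T &, forall f g, f != g -> [disjoint copy_vertices f & copy_vertices g]}.

Definition covered (H G : sgraph) (T : {set {ffun H -> G}}) : {set G} :=
  \bigcup_(f in T) copy_vertices f.

(* Main.v *)
Require Import Defs.
From mathcomp Require Import all_boot all_order all_algebra.
From mathcomp Require Import reals zify ring lra.

(* Put [h0 = (r-1) h], [s0 = (r-1) sigma], [w0 = h - sigma]. An [m]-bottle is a complete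
   [r]-partite graph with one part (the neck) of size [s0 m] and the others of size [w0 m];
   the vertices of a 1-bottle are partitioned by [r-1] copies of [H], so it suffices to tile
   almost all of [G] with bottles. No regularity lemma is used: a tiling by [C m]-bottles,
   where [C] does not depend on [m], is improved to a better tiling by [m]-bottles, and
   starting from bottles that are large enough this can be iterated.

   Rank the vertices by degree. Every uncovered [x] has so many neighbours in the tiling
   that for linearly many tiles [T] one of the following holds: [x] has many neighbours in
   all parts of [T]; in all parts but the neck, and [s0 < w0]; in all parts but one, and
   that part has many vertices of rank well above that of [x]. By pigeonhole, some [T] has
   many such [x] with the same neighbours in [T]. In the first two cases part of [T] and
   these [x] can be retiled so as to cover more vertices, in the third [x] replaces a vertex
   of higher rank. The potential [1 - I v / (2 w0 n)], summed over the covered [v] of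
   rank [I v], increases in all three cases.

   The count works only if few neighbours of [x] are uncovered. So start from the complete
   graph and give up the surplus edges of few vertices at a time, in order of rank: one such
   step destroys only a small proportion of the tiling, which the improvement then repairs. *)

Set Implicit Arguments.
Unset Strict Implicit.
Unset Printing Implicit Defensive.
Import Order.TTheory GRing.Theory Num.Theory.

(** * Disjoint choices of prescribed size *)

Lemma allocation (V K I : finType) (P : I -> {set V}) (phi : K -> I) :
  (forall i j, i != j -> [disjoint P i & P j]) ->
  (forall i, #|[set k | phi k == i]| <= #|P i|) ->
  exists2 g : K -> V, injective g & forall k, g k \in P (phi k).
Proof.
move=> disP leP.
have [x0 _|V0] := pickP (xpredT : pred V); last first.
  have K0 (k : K) : False.
    have := leP (phi k); rewrite (cardsD1 k) inE eqxx.
    by rewrite (eq_card0 (A := P _)) // => y; have := V0 y.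
  by exists (fun k => match K0 k with end) => k; case: (K0 k).
(* [g] sends [k] to the element of [P (phi k)] whose position is that of [k] in its own fibre of
   [phi]; the size bound makes this position valid. *)
pose idx k := index k (enum [set k' | phi k' == phi k]).
have in_cls k : k \in enum [set k' | phi k' == phi k] by rewrite mem_enum inE.
have lt_idx k : idx k < size (enum (P (phi k))).
  by rewrite -cardE (leq_trans _ (leP _)) // cardE index_mem.
pose g k := nth x0 (enum (P (phi k))) (idx k).
have gP k : g k \in P (phi k) by rewrite -mem_enum mem_nth.
exists g => // k k' eg; have [ephi|nphi] := eqVneq (phi k) (phi k').
  have lt' : idx k < size (enum (P (phi k'))) by rewrite -ephi.
  have : idx k == idx k'.
    by rewrite -(nth_uniq x0 lt' (lt_idx k') (enum_uniq _)) -{1}ephi; apply/eqP.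
  rewrite /idx -ephi => /eqP ei.
  rewrite -(nth_index k (in_cls k)) ei nth_index //.
  by rewrite mem_enum inE ephi.
have := disjointFr (disP _ _ nphi) (gP k).
by rewrite eg gP.
Qed.

(** Reduces to [allocation] by giving each [k] exactly [D k] tokens, each of which claims one
    vertex. *)
Lemma allocation_sets (V K I : finType) (P : I -> {set V}) (phi : K -> I)
    (D : K -> nat) :
  (forall i j, i != j -> [disjoint P i & P j]) ->
  (forall i, \sum_(k | phi k == i) D k <= #|P i|) ->
  exists S : K -> {set V},
    [/\ forall k, S k \subset P (phi k), forall k, #|S k| = D k
      & forall k k', k != k' -> [disjoint S k & S k']].
Proof.
move=> disP leP; pose K' := {k : K & 'I_(D k)}.
have [|g g_inj gP] := @allocation V K' I P (fun u => phi (tag u)) disP.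
  move=> i; apply: leq_trans (leP i); rewrite cardsE -sum1_card.
  have -> : \sum_(u : K' | u \in [pred u | phi (tag u) == i]) 1 =
      \sum_(k | phi k == i) \sum_(x : 'I_(D k)) 1.
    by rewrite sig_big_dep; apply: eq_bigl => u; rewrite andbT.
  by apply: leq_sum => k _; rewrite sum1_card card_ord.
exists (fun k => [set g (existT _ k x) | x : 'I_(D k)]); split=> [k|k|k k' nk].
- by apply/subsetP => _ /imsetP[x _ ->]; apply: (gP (existT _ k x)).
- rewrite card_imset ?card_ord // => x y /g_inj/eqP.
  by rewrite -tag_eqE /tag_eq eqxx tagged_asE => /eqP.
- rewrite -setI_eq0; apply/eqP/setP => v; rewrite !inE; apply/negP.
  case/andP=> /imsetP[x _ ->] /imsetP[y _ /g_inj/(congr1 tag) /= ek].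
  by rewrite ek eqxx in nk.
Qed.

(** * Bottles and their coverage *)

Section Bottles.
Variables (V : finType) (k : nat).
Implicit Types (e : rel V) (a : 'I_k.+1 -> nat).

Definition tile := {ffun 'I_k.+1 -> {set V}}.
Implicit Types (T : tile) (s : seq tile).

(** Counted with multiplicity over tiles and parts, so that it is additive under concatenation;
    disjointness of the tiles is then expressed as [cov s v <= 1]. *)
Definition cov s (v : V) : nat := \sum_(T <- s) \sum_j (v \in T j).

Definition bottle e a m T : Prop :=
  (forall j, #|T j| = a j * m) /\
  (forall i j, i != j -> forall x y, x \in T i -> y \in T j -> e x y).

Definition bottles e a m s : Prop := forall T, T \in s -> bottle e a m T.

Lemma cov_nil v : cov [::] v = 0. Proof. exact: big_nil. Qed.

Lemma cov_cat s1 s2 v : cov (s1 ++ s2) v = cov s1 v + cov s2 v.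
Proof. exact: big_cat. Qed.

Lemma cov_cons T s v : cov (T :: s) v = cov [:: T] v + cov s v.
Proof. by rewrite -cov_cat. Qed.

Lemma cov_perm s1 s2 v : perm_eq s1 s2 -> cov s1 v = cov s2 v.
Proof. exact: perm_big. Qed.

Lemma cov1 T v : cov [:: T] v = \sum_j (v \in T j).
Proof. exact: big_seq1. Qed.

Lemma bottles_cat e a m s1 s2 :
  bottles e a m s1 -> bottles e a m s2 -> bottles e a m (s1 ++ s2).
Proof. by move=> b1 b2 T; rewrite mem_cat => /orP[/b1|/b2]. Qed.

Lemma bottles1 e a m T : bottle e a m T -> bottles e a m [:: T].
Proof. by move=> bT T'; rewrite inE => /eqP->. Qed.

Lemma sub_bottles e a m s1 s2 :
  {subset s1 <= s2} -> bottles e a m s2 -> bottles e a m s1.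
Proof. by move=> s12 b2 T /s12/b2. Qed.

Lemma sum_mem (A B : {set V}) : \sum_(v in A) (v \in B) = #|A :&: B|.
Proof.
rewrite -sum1_card big_mkcond [RHS]big_mkcond /=.
by apply: eq_bigr => v _; rewrite inE; case: (v \in A) (v \in B) => [] [].
Qed.

Lemma sum_cov e a m s :
  bottles e a m s -> \sum_v cov s v = size s * ((\sum_j a j) * m).
Proof.
elim: s => [_|T s IH bs]; first by rewrite big1 // => v _; rewrite cov_nil.
under eq_bigr do rewrite cov_cons cov1.
rewrite big_split /= IH; last by apply: sub_bottles bs => T'; rewrite inE orbC => ->.
rewrite mulSn; congr addn; rewrite exchange_big /= big_distrl /=.
apply: eq_bigr => j _; rewrite -(bs T _).1 ?mem_head //.
rewrite (eq_bigl [in [set: V]]) ?sum_mem ?setTI // => v.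
by rewrite inE.
Qed.

(** Here [f l j] is the pool from which part [j] of the [l]-th bottle is drawn. When the demand on a
    pool equals its size, the exact count and [cov_eq1] show that the whole pool is covered.
    Adjacency is asked of distinct vertices only, so that parts of a bottle may share a pool. *)
Lemma allocate_bottles e a (L I : finType) (P : I -> {set V})
    (f : L -> 'I_k.+1 -> I) q :
  (forall i j, i != j -> [disjoint P i & P j]) ->
  (forall l i j, i != j -> forall x y, x != y ->
     x \in P (f l i) -> y \in P (f l j) -> e x y) ->
  (forall i, \sum_l \sum_(j | f l j == i) a j * q <= #|P i|) ->
  exists s, [/\ bottles e a q s, forall v, cov s v <= (v \in \bigcup_i P i)
    & forall i, \sum_(v in P i) cov s v = \sum_l \sum_(j | f l j == i) a j * q].
Proof.
move=> disP eP leP.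
have [|S [SP cS disS]] := @allocation_sets V (L * 'I_k.+1)%type I P
    (fun u => f u.1 u.2) (fun u => a u.2 * q) disP.
  by move=> i; rewrite -(pair_big_dep xpredT (fun l j => f l j == i)
       (fun l j => a j * q)).
pose s : seq tile := [seq [ffun j => S (l, j)] | l : L].
have covE v : cov s v = \sum_u (v \in S u).
  rewrite /cov big_map big_enum /=.
  under [RHS]eq_bigr do rewrite [X in S X]surjective_pairing.
  rewrite -(pair_bigA _ (fun l j => v \in S (l, j) : nat)) /=.
  by apply: eq_bigr => l _; apply: eq_bigr => j _; rewrite ffunE.
exists s; split.
- move=> _ /mapP[l _ ->]; split=> [j|i j nij x y]; rewrite !ffunE ?cS //.
  move=> xS yS; apply: (eP l i j nij); try exact: (subsetP (SP (l, _))).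
  apply: contraTneq xS => ->; rewrite (disjointFl (disS _ (l, j) _) yS) //.
  by rewrite xpair_eqE eqxx.
- move=> v; rewrite covE.
  have [/existsP[u vu]|/existsPn nS] := boolP [exists u, v \in S u].
    rewrite (bigD1 u) //= vu big1 => [|u' nu]; last first.
      by rewrite (disjointFl (disS _ _ nu) vu).
    suff -> : v \in \bigcup_i P i by [].
    by apply/bigcupP; exists (f u.1 u.2) => //; apply: (subsetP (SP u)).
  by rewrite big1 // => u _; rewrite (negbTE (nS u)).
- move=> i; under eq_bigr do rewrite covE.
  rewrite exchange_big /= (pair_big_dep xpredT (fun l j => f l j == i)
       (fun l j => a j * q)) /= [RHS]big_mkcond /=.
  apply: eq_bigr => u _; rewrite sum_mem; case: eqVneq => [<-|nu].
    by rewrite (setIidPr (SP u)) cS.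
  apply: eq_card0 => v; rewrite !inE; apply/negP => /andP[vi vS].
  by have := disjointFr (disP _ _ nu) (subsetP (SP u) _ vS); rewrite vi.
Qed.

Lemma cov_eq1 (f : V -> nat) (A : {set V}) :
  (forall v, f v <= 1) -> \sum_(v in A) f v = #|A| ->
  {in A, forall v, f v = 1}.
Proof.
move=> f1 sf v vA; apply/eqP; rewrite eqn_leq f1 lt0n; apply/eqP => fv0.
have : \sum_(v in A) f v < #|A|; last by rewrite sf ltnn.
rewrite -sum1_card (bigD1 v) //= fv0 (bigD1 (P := [in A]) v) //= ltnS add0n.
by apply: leq_sum.
Qed.

Lemma cov_notin (s : seq tile) (B : {set V}) v :
  (forall v, cov s v <= (v \in B)) -> v \notin B -> cov s v = 0.
Proof. by move=> /(_ v) + /negbTE vB; rewrite vB leqn0 => /eqP. Qed.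

Lemma bottle_disjoint e a m T i j :
  irreflexive e -> bottle e a m T -> i != j -> [disjoint T i & T j].
Proof.
move=> eI [_ eT] nij; rewrite -setI_eq0; apply/eqP/setP => v; rewrite !inE.
by apply/negP => /andP[vi vj]; have := eT i j nij v v vi vj; rewrite eI.
Qed.

Lemma cov1E e a m T v :
  irreflexive e -> bottle e a m T -> cov [:: T] v = (v \in \bigcup_j T j).
Proof.
move=> eI bT; rewrite cov1; have [/bigcupP[j _ vj]|nv] := boolP (v \in _).
  rewrite (bigD1 j) //= vj big1 // => i nij.
  by rewrite (disjointFl (bottle_disjoint eI bT nij) vj).
rewrite big1 // => j _; case: (boolP (v \in T j)) => // vj.
by case/negP: nv; apply/bigcupP; exists j.
Qed.

Lemma card_bottle e a m T :
  irreflexive e -> bottle e a m T -> #|\bigcup_j T j| = (\sum_j a j) * m.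
Proof.
move=> eI bT; have := sum_cov (bottles1 bT); rewrite mul1n => <-.
under [RHS]eq_bigr do rewrite (cov1E _ eI bT).
by rewrite -[in LHS]sum1_card [LHS]big_mkcond; apply: eq_bigr => v _; case: ifP.
Qed.

(** Each part is its own pool and is drawn on by [t] bottles of level [m], which exhaust it. *)
Lemma split_bottle e a t m T :
  irreflexive e -> bottle e a (t * m) T ->
  exists2 s, bottles e a m s & cov s =1 cov [:: T].
Proof.
move=> eI bT.
have [||i|s [bs cs ds]] := @allocate_bottles e a 'I_t 'I_k.+1 T (fun _ j => j) m.
- by move=> i j; apply: bottle_disjoint bT.
- by move=> _ i j nij x y _; apply: bT.2.
- by under eq_bigr do rewrite big_pred1_eq; rewrite sum_nat_const card_ord bT.1 mulnCA.
exists s => // v; rewrite (cov1E _ eI bT).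
have [/bigcupP[j _ vj]|nv] := boolP (v \in _); last exact: (cov_notin cs nv).
apply: (cov_eq1 (A := T j)) vj => [u|]; first by apply: leq_trans (cs u) (leq_b1 _).
rewrite ds; under eq_bigr do rewrite big_pred1_eq.
by rewrite sum_nat_const card_ord bT.1 mulnCA.
Qed.

Lemma split_bottles e a t m s :
  irreflexive e -> bottles e a (t * m) s ->
  exists2 s', bottles e a m s' & cov s' =1 cov s.
Proof.
move=> eI; elim: s => [|T s IH] bs.
  by exists [::].
have [|s1 b1 c1] := IH; first by apply: sub_bottles bs => T'; rewrite inE orbC => ->.
have [|s2 b2 c2] := @split_bottle e a t m T eI; first by apply: bs; rewrite mem_head.
exists (s2 ++ s1); first exact: bottles_cat.
by move=> v; rewrite cov_cat c1 c2 -cov_cons.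
Qed.

Lemma bottleD e a K p T (P : 'I_k.+1 -> {set V}) :
  bottle e a (K.+1 * p) T -> (forall j, P j \subset T j) ->
  (forall j, #|P j| = a j * p) ->
  bottle e a (K * p) [ffun j => T j :\: P j].
Proof.
move=> [cT eT] PT cP; split=> [j|i j nij x y]; rewrite !ffunE.
  by rewrite cardsD (setIidPr (PT j)) cT cP mulSn mulnDr addKn.
by rewrite !inE => /andP[_ xi] /andP[_ yj]; apply: (eT i j).
Qed.

Lemma subset_card (A : {set V}) q : q <= #|A| -> exists2 B : {set V}, B \subset A & #|B| = q.
Proof.
move=> qA; exists [set x in take q (enum A)].
  by apply/subsetP => x; rewrite inE => /mem_take; rewrite mem_enum.
by rewrite cardsE (card_uniqP _) ?take_uniq ?enum_uniq // size_take -cardE; case: ltngtP qA.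
Qed.

End Bottles.

(** * Local improvements *)

Definition covered_weight (R : pzSemiRingType) (V : finType) (k : nat) (c : V -> R)
    (s : seq (tile V k)) : R :=
  (\sum_v c v * (cov s v)%:R)%R.

Lemma covered_weight_cat (R : pzSemiRingType) (V : finType) (k : nat) (c : V -> R)
    (s1 s2 : seq (tile V k)) :
  (covered_weight c (s1 ++ s2) = covered_weight c s1 + covered_weight c s2)%R.
Proof.
rewrite /covered_weight -big_split; apply: eq_bigr => v _ /=.
by rewrite cov_cat natrD mulrDr.
Qed.

Lemma eq_covered_weight (R : pzSemiRingType) (V : finType) (k : nat) (c : V -> R)
    (s1 s2 : seq (tile V k)) :
  cov s1 =1 cov s2 -> covered_weight c s1 = covered_weight c s2.
Proof. by move=> e12; apply: eq_bigr => v _; rewrite e12. Qed.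

Section Moves.
Variables (R : realFieldType) (V : finType) (k s0 w0 : nat).
Variables (e : rel V) (c : V -> R).
Hypotheses (e_sym : symmetric e) (e_irr : irreflexive e).
Hypotheses (k_gt0 : 0 < k) (s0_gt0 : 0 < s0) (s0_le_w0 : s0 <= w0).
Hypotheses (c_le1 : forall v, (c v <= 1)%R)
  (c_ge : forall v, (1 - (2 * w0%:R)^-1 <= c v)%R).

Definition part_size (j : 'I_k.+1) := if j == ord0 then s0 else w0.

Definition height := k * w0 + s0.

Lemma sum_part_size : \sum_j part_size j = height.
Proof.
rewrite big_ord_recl /part_size eqxx /= addnC; congr addn.
by rewrite sum_nat_const card_ord.
Qed.

Lemma part_size_le j : part_size j <= w0.
Proof. by rewrite /part_size; case: ifP. Qed.

Lemma part_size_ge j : s0 <= part_size j.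
Proof. by rewrite /part_size; case: ifP. Qed.

Local Notation Phi := (@covered_weight R V k c).

Lemma c_ge_half v : (1 / 2 <= c v)%R.
Proof.
apply: le_trans (c_ge v); have w01 : (1 <= w0%:R :> R)%R.
  by rewrite ler1n (leq_trans s0_gt0).
rewrite lerBrDr -lerBrDl invfM; apply: (@le_trans _ _ (2^-1 * 1)%R); last lra.
by rewrite ler_wpM2l ?invr_ge0 // invf_le1 // (lt_le_trans _ w01).
Qed.

Lemma c_ge0 v : (0 <= c v)%R.
Proof. by apply: le_trans (c_ge_half v); lra. Qed.

Lemma Phi_bottle m T : bottle e part_size m T ->
  Phi [:: T] = (\sum_(v in \bigcup_j T j) c v)%R.
Proof.
move=> bT; rewrite [RHS]big_mkcond; apply: eq_bigr => v _ /=.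
by rewrite (cov1E _ e_irr bT); case: ifP; rewrite ?mulr1 ?mulr0.
Qed.

(** The sub-bottle [P] is cut out of [T], and [s1] retiles part of [P] and [X]. What remains of [T]
    is still a bottle; both it and the tiles of [s1] split into bottles of level [m], so the levels
    stay uniform. *)
Lemma replace_part m t u K (T : tile V k) (P : 'I_k.+1 -> {set V}) (X : {set V}) s1 :
  bottle e part_size (K.+1 * (u * m)) T -> [disjoint \bigcup_j T j & X] ->
  (forall j, P j \subset T j) -> (forall j, #|P j| = part_size j * (u * m)) ->
  bottles e part_size (t * m) s1 ->
  (forall v, cov s1 v <= (v \in (\bigcup_j P j) :|: X)) ->
  exists s, [/\ bottles e part_size m s,
    forall v, cov s v <= (v \in (\bigcup_j T j) :|: X)
    & (Phi s = Phi [:: T] + Phi s1 - \sum_(v in \bigcup_j P j) c v)%R].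
Proof.
move=> bT dTX PT cP b1 c1; set TP : tile V k := [ffun j => T j :\: P j].
have bTP : bottle e part_size (K * u * m) TP by rewrite -mulnA; apply: bottleD bT PT cP.
have [s2 b2 c2] := split_bottle e_irr bTP.
have [s3 b3 c3] := split_bottles e_irr b1.
have PT' : \bigcup_j P j \subset \bigcup_j T j.
  by apply/bigcupsP => j _; apply: subset_trans (PT j) (bigcup_sup _ _).
have TPE v : (v \in \bigcup_j TP j) = (v \in \bigcup_j T j) && (v \notin \bigcup_j P j).
  apply/bigcupP/andP => [[j _]|[/bigcupP[j _ vT] vP]].
    rewrite ffunE inE => /andP[vP vT]; split; first by apply/bigcupP; exists j.
    apply/bigcupP => -[i _ vi]; case/negP: vP; have [<-//|nij] := eqVneq i j.
    have := disjointFr (bottle_disjoint e_irr bT nij) (subsetP (PT i) _ vi).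
    by rewrite vT.
  exists j; rewrite // ffunE inE vT andbT; apply: contra vP => vP.
  by apply/bigcupP; exists j.
exists (s2 ++ s3); split; first exact: bottles_cat.
  move=> v; rewrite cov_cat c2 c3 (cov1E _ e_irr bTP) TPE inE.
  have := c1 v; rewrite inE; have := subsetP PT' v.
  have := disjointFr dTX (x := v).
  by case: (v \in \bigcup_j T j); case: (v \in \bigcup_j P j);
     case: (v \in X) => //= d1 d2; rewrite ?add0n //; lia.
rewrite covered_weight_cat (eq_covered_weight c c2) (eq_covered_weight c c3).
rewrite (Phi_bottle bTP) (Phi_bottle bT).
rewrite [in RHS](bigID [in \bigcup_j P j]) /=.
under [X in (_ = _ + X + _ - _)%R]eq_bigl do rewrite -TPE.
under [X in (_ = X + _ + _ - _)%R]eq_bigl => v.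
  rewrite andb_idl; first over.
  exact: (subsetP PT').
ring.
Qed.

Section Extended.
Variables (m K : nat) (T : tile V k) (P : 'I_k.+1 -> {set V}) (X : {set V}).
(** This factor lets the new bottles of [full_move] and [neck_move] exhaust the old parts that they
    use without rounding. *)
Let c1 := k * (height - w0).
Let p := c1 * m.
Hypotheses (m_gt0 : 0 < m) (bT : bottle e part_size (K.+1 * p) T)
  (dTX : [disjoint \bigcup_j T j & X]).
Hypotheses (PT : forall j, P j \subset T j) (cP : forall j, #|P j| = part_size j * p).

Let PX (o : option 'I_k.+1) := if o is Some j then P j else X.

Lemma heightB : height - w0 = k.-1 * w0 + s0.
Proof. by rewrite /height -{1}(prednK k_gt0) mulSn -addnA addKn. Qed.

Lemma p_gt0 : 0 < p.
Proof.
rewrite /p /c1 !muln_gt0 k_gt0 m_gt0 heightB andbT /=.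
by rewrite (leq_trans s0_gt0) ?leq_addl.
Qed.

Lemma P_gt0 j : 0 < #|P j|.
Proof. by rewrite cP muln_gt0 p_gt0 andbT (leq_trans s0_gt0) ?part_size_ge. Qed.

Lemma PX_disjoint i j : i != j -> [disjoint PX i & PX j].
Proof.
have dPX i' : [disjoint P i' & X].
  apply: disjointWl dTX; apply: subset_trans (PT _) (bigcup_sup _ _) => //.
case: i j => [i|] [j|] //= nij; last by rewrite disjoint_sym.
apply: disjointW (PT _) (PT _) _; apply: bottle_disjoint e_irr bT _.
by apply: contraNneq nij => ->.
Qed.

Lemma PX_cup : \bigcup_o PX o = (\bigcup_j P j) :|: X.
Proof.
apply/setP => v; rewrite inE; apply/bigcupP/orP.
  by case=> -[j|] _ vj; [left; apply/bigcupP; exists j|right].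
by case=> [/bigcupP[j _ vj]|vX]; [exists (Some j)|exists None].
Qed.

Let dem (L : finType) (f : L -> 'I_k.+1 -> option 'I_k.+1) q o :=
  \sum_l \sum_(i | f l i == o) part_size i * q.

(** Parts of [P] that the new bottles exhaust stay covered and keep their weight; the other parts
    are counted as lost altogether. The net change is at least the weight gained on [X] minus the
    weight of the lost parts. *)
Lemma extended_move (L : finType) (f : L -> 'I_k.+1 -> option 'I_k.+1) t :
  (forall l, injective (f l)) ->
  (forall l i j, f l i = Some j -> forall x y, x \in X -> y \in P j -> e x y) ->
  (forall o, dem f (t * m) o <= #|PX o|) ->
  exists s (u : V -> nat), [/\ bottles e part_size m s,
    forall v, cov s v <= (v \in (\bigcup_j T j) :|: X),
    \sum_(v in X) u v = dem f (t * m) None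
    & (Phi [:: T] + \sum_(v in X) c v * (u v)%:R
       - \sum_(j | dem f (t * m) (Some j) != #|P j|) \sum_(v in P j) c v <= Phi s)%R].
Proof.
move=> f_inj fX fle.
have [|s1 [b1 cov1 d1]] := allocate_bottles (e := e) PX_disjoint _ fle.
  move=> l i j nij x y nxy; case Ei: (f l i) => [i1|] /=; case Ej: (f l j) => [j1|] /=.
  - move=> xi yj; apply: (bT.2 i1 j1); try exact: (subsetP (PT _)).
    by apply: contraNneq nij => eij; apply/eqP/(f_inj l); rewrite Ei Ej eij.
  - by move=> xi yX; rewrite e_sym; apply: (fX l i i1 Ei).
  - exact: (fX l j j1 Ej).
  - by move=> _ _; case/eqP: nij; apply: (f_inj l); rewrite Ei Ej.
have [|s [bs cs Ps]] := replace_part bT dTX PT cP b1.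
  by move=> v; rewrite -PX_cup.
exists s, (cov s1); split=> //; first exact: d1 None.
have PhiX : (\sum_(v in X) c v * (cov s1 v)%:R
    + \sum_j \sum_(v in P j) c v * (cov s1 v)%:R <= Phi s1)%R.
  have -> : (\sum_(v in X) c v * (cov s1 v)%:R
    + \sum_j \sum_(v in P j) c v * (cov s1 v)%:R =
    \sum_(v in \bigcup_o PX o) c v * (cov s1 v)%:R)%R.
    rewrite partition_disjoint_bigcup; last exact: PX_disjoint.
    rewrite (bigD1 None) //=; congr (_ + _)%R.
    rewrite (reindex_omap Some id) /=; last by case.
    by apply: eq_bigl => j; rewrite eqxx.
  rewrite big_mkcond; apply: ler_sum => v _; case: ifP => // _.
  by rewrite mulr_ge0 ?ler0n ?c_ge0.
rewrite Ps partition_disjoint_bigcup; last first.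
  move=> i j nij; apply: (PX_disjoint (i := Some i) (j := Some j)).
  by rewrite -(inj_eq Some_inj) in nij.
rewrite (bigID (fun j => dem f (t * m) (Some j) == #|P j|) xpredT) /=.
suff : (\sum_(j | dem f (t * m) (Some j) == #|P j|) \sum_(v in P j) c v <=
    \sum_j \sum_(v in P j) c v * (cov s1 v)%:R)%R by lra.
rewrite big_mkcond; apply: ler_sum => j _; case: eqP => [fj|_]; last first.
  by apply: sumr_ge0 => v _; rewrite mulr_ge0 ?ler0n ?c_ge0.
apply: ler_sum => v vj; rewrite (cov_eq1 (A := P j) (f := cov s1)) ?mulr1 //.
  by move=> y; apply: leq_trans (cov1 y) (leq_b1 _).
by rewrite (d1 (Some j)).
Qed.

(* The [l]-th new bottle uses [X] in place of part [l]. *)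
Lemma full_move :
  (forall x j y, x \in X -> y \in P j -> e x y) -> height * p <= #|X| ->
  exists s, [/\ bottles e part_size m s,
    forall v, cov s v <= (v \in (\bigcup_j T j) :|: X)
    & (Phi [:: T] + p%:R / 2 <= Phi s)%R].
Proof.
move=> eX leX; pose f (l i : 'I_k.+1) := if i == l then None else Some i.
(* Each old part serves the [k] new bottles other than its own, so level [t * m] exhausts it
   exactly. *)
set t := height - w0; have pE : p = k * (t * m) by rewrite /p /c1 -mulnA.
have demS i : dem f (t * m) (Some i) = #|P i|.
  rewrite cP pE /dem (bigD1 i) //= big_pred0 => [|j /=]; last first.
    by rewrite /f; case: (eqVneq j i) => // nij; rewrite (inj_eq Some_inj) (negbTE nij).
  rewrite add0n (eq_bigr (fun _ => part_size i * (t * m))) => [|l nli].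
    by rewrite sum_nat_const cardC1 card_ord /= mulnCA.
  rewrite (big_pred1 i) // => j /=; rewrite /f; case: (eqVneq j l) => [->|_].
    by rewrite (negbTE nli).
  by rewrite (inj_eq Some_inj).
have demN : dem f (t * m) None = height * (t * m).
  rewrite /dem -sum_part_size big_distrl /=. apply: eq_bigr => l _.
  by rewrite (big_pred1 l) // => j /=; rewrite /f; case: (eqVneq j l).
have [|l i j|[i|]|s [u [bs cs us]]] := @extended_move _ f t.
- by move=> l i j /=; rewrite /f; case: (eqVneq i) => [->|_]; case: (eqVneq j) => // _ [].
- by rewrite /f; case: (eqVneq i l) => // _ [<-] x y xX; apply: eX xX.
- by rewrite demS.
- by rewrite demN /= (leq_trans _ leX) // pE leq_mul // leq_pmull.
rewrite [X in (_ + _ - X <= _)%R]big_pred0 => [Ps|i]; last by rewrite demS eqxx.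
exists s; split=> //; apply: le_trans Ps; rewrite subr0 lerD2l.
apply: le_trans (_ : (\sum_(v in X) (1 / 2) * (u v)%:R <= _)%R); last first.
  by apply: ler_sum => v _; rewrite ler_wpM2r ?ler0n // c_ge_half.
rewrite -big_distrr /= -natr_sum us demN mul1r mulrC ler_pM2l ?invr_gt0 ?ltr0n //.
rewrite ler_nat pE leq_mul2r; apply/orP; right.
by rewrite /height (leq_trans _ (leq_addr _ _)) // leq_pmulr // (leq_trans s0_gt0).
Qed.

(* The neck of the [l]-th new bottle lies in the [l]-th wide part, and [X] takes the place of
   that part; the old neck is given up. As a new bottle takes less from the wide parts than an
   old one, there are enough of them to gain. *)
Lemma neck_move : s0 < w0 ->
  (forall x j y, x \in X -> j != ord0 -> y \in P j -> e x y) ->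
  height * height * p <= #|X| ->
  exists s, [/\ bottles e part_size m s,
    forall v, cov s v <= (v \in (\bigcup_j T j) :|: X)
    & (Phi [:: T] + p%:R / 2 <= Phi s)%R].
Proof.
move=> s0w0 eX leX; pose f (l : 'I_k) (i : 'I_k.+1) :=
  if i == lift ord0 l then None
  else if i == ord0 then Some (lift ord0 l) else Some i.
(* A wide part serves as the neck of one new bottle and as a wide part of [k - 1] others. Its demand
   per unit of level is [s0 + (k - 1) w0 = height - w0], so level [k w0 m] uses exactly its [w0 p]
   vertices. *)
set t := k * w0.
have demS i : dem f (t * m) (Some (lift ord0 i)) = #|P (lift ord0 i)|.
  have shL : part_size (lift ord0 i) = w0 by rewrite /part_size eq_sym (negbTE (neq_lift _ _)).
  rewrite cP shL /dem (bigD1 i) //= (big_pred1 ord0) => [|j /=]; last first.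
    rewrite /f; case: (eqVneq j (lift ord0 i)) => [->|nj].
      by rewrite [RHS]eq_sym (negbTE (neq_lift _ _)).
    by case: (eqVneq j ord0) => _; rewrite (inj_eq Some_inj) ?eqxx // (negbTE nj).
  rewrite (eq_bigr (fun _ => w0 * (t * m))) => [|l nli].
    rewrite sum_nat_const cardC1 card_ord /part_size eqxx /p /c1 heightB /t.
    ring.
  rewrite (big_pred1 (lift ord0 i)) ?shL // => j /=; rewrite /f.
  case: (eqVneq j (lift ord0 l)) => [->|_].
    by rewrite (inj_eq lift_inj) (negbTE nli).
  case: (eqVneq j ord0) => [->|_]; rewrite (inj_eq Some_inj) //.
  by rewrite (inj_eq lift_inj) (negbTE nli) (negbTE (neq_lift _ _)).
have demS0 : dem f (t * m) (Some ord0) = 0.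
  rewrite /dem big1 // => l _; rewrite big_pred0 // => j /=; rewrite /f.
  case: (eqVneq j (lift ord0 l)) => // nj.
  case: (eqVneq j ord0) => [_|nj0]; rewrite (inj_eq Some_inj).
    by rewrite eq_sym (negbTE (neq_lift _ _)).
  exact: negbTE.
have demN : dem f (t * m) None = k * w0 * (t * m).
  rewrite /dem (eq_bigr (fun _ => w0 * (t * m))) => [|l _].
    by rewrite sum_nat_const card_ord mulnA.
  rewrite (big_pred1 (lift ord0 l)) => [|j /=]; last first.
    by rewrite /f; case: (eqVneq j (lift ord0 l)) => // _; case: (eqVneq j ord0).
  by rewrite /part_size eq_sym (negbTE (neq_lift _ _)).
have w0_gt0 : 0 < w0 by apply: leq_trans s0_le_w0.
have [||[i|]|s [u [bs cs us]]] := @extended_move _ f t.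
- move=> l i j /=; rewrite /f.
  case: (eqVneq i) => [->|ni]; case: (eqVneq j) => [->|nj] //.
  + by case: (eqVneq j).
  + by case: (eqVneq i).
  + case: (eqVneq i ord0) => [->|ni0]; case: (eqVneq j ord0) => [->|nj0] // [ej].
    * by rewrite -ej eqxx in nj.
    * by rewrite ej eqxx in ni.
    * by [].
- move=> l i j /=; rewrite /f; case: (eqVneq i (lift ord0 l)) => // ni.
  by case: (eqVneq i ord0) => [_|ni0] [<-] x y xX yP; apply: eX xX _ yP.
- by case: (unliftP ord0 i) => [j ->|->]; rewrite ?demS ?demS0.
- rewrite demN /= (leq_trans _ leX) // /p /c1 /t.
  rewrite (_ : k * w0 * (k * w0 * m) = (k * w0) * (k * w0) * (1 * m)); last by ring.
  have := leq_addr s0 (k * w0); rewrite -/height => kh.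
  rewrite leq_mul ?leq_mul // muln_gt0 k_gt0 /= heightB.
  by rewrite (leq_trans s0_gt0) ?leq_addl.
move=> Ps; exists s; split=> //; apply: le_trans Ps.
have -> : (\sum_(j | dem f (t * m) (Some j) != #|P j|) \sum_(v in P j) c v =
    \sum_(v in P ord0) c v)%R.
  rewrite (big_pred1 ord0) // => j /=; case: (unliftP ord0 j) => [i ->|->].
    by rewrite demS eqxx eq_sym (negbTE (neq_lift _ _)).
  by rewrite demS0 eqxx eq_sym -lt0n P_gt0.
have P0le : (\sum_(v in P ord0) c v <= (s0 * p)%:R)%R.
  have <- : #|P ord0| = s0 * p by rewrite cP /part_size eqxx.
  rewrite -sum1_card natr_sum; exact: ler_sum.
have Xge : ((1 - (2 * w0%:R)^-1) * (k * w0 * (t * m))%:R <= \sum_(v in X) c v * (u v)%:R)%R.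
  rewrite -demN -us natr_sum big_distrr /=.
  by apply: ler_sum => v _; rewrite ler_wpM2r ?ler0n.
rewrite -addrA lerD2l (le_trans _ (lerB Xge P0le)) //.
rewrite /p /c1 /t heightB; move: k_gt0; case: (k) => // k' _ /=.
rewrite !natrM !natrD natrM; have : (s0%:R + 1 <= w0%:R :> R)%R by rewrite natr1 ler_nat.
set W : R := w0%:R%R; set S : R := s0%:R%R; set M : R := m%:R%R.
set k1 : R := k'%:R%R => SW.
have S0 : (0 <= S)%R by rewrite ler0n.
have M0 : (0 <= M)%R by rewrite ler0n.
have k1_ge0 : (0 <= k1)%R by rewrite ler0n.
have -> : (k'.+1%:R = k1 + 1 :> R)%R by rewrite natr1.
have -> : ((1 - (2 * W)^-1) * ((k1 + 1) * W * ((k1 + 1) * W * M)) =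
    (k1 + 1) * M * ((W - 1 / 2) * ((k1 + 1) * W)))%R.
  by field; apply: lt0r_neq0; lra.
have kW : (0 <= k1 * W)%R by apply: mulr_ge0 => //; lra.
(* Up to the factor [k m], [X] brings at least the right side and the neck costs at most
   [S (k1 W + S)]; the remaining half is the gain. As [s0 < w0] are integers, [S + 1/2 <= W - 1/2],
   so the slope of the weights is too small to spoil the gain. *)
have le1 : ((S + 1 / 2) * (k1 * W + S) <= (W - 1 / 2) * ((k1 + 1) * W))%R.
  by apply: ler_pM; lra.
have aM : (0 <= (k1 + 1) * M)%R by rewrite mulr_ge0 // addr_ge0.
have := ler_wpM2l aM le1; lra.
Qed.

(** A single new bottle of level [p] takes [X] for part [j0] and exhausts all other parts, so only
    the weights of [X] and [P j0] have to be compared. *)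
Lemma swap_move j0 (g : R) : (0 <= g)%R ->
  (forall x j y, x \in X -> j != j0 -> y \in P j -> e x y) ->
  (forall x y, x \in X -> y \in P j0 -> c y + g <= c x)%R ->
  w0 * p <= #|X| ->
  exists s, [/\ bottles e part_size m s,
    forall v, cov s v <= (v \in (\bigcup_j T j) :|: X)
    & (Phi [:: T] + g * p%:R <= Phi s)%R].
Proof.
move=> g0 eX gX leX; pose f (l : unit) (i : 'I_k.+1) := if i == j0 then None else Some i.
set t := c1.
have demS i : dem f (t * m) (Some i) = if i == j0 then 0 else #|P i|.
  rewrite /dem (big_pred1 tt); last by case.
  case: eqVneq => [->|nij].
    rewrite big_pred0 // => j; rewrite /f; case: (eqVneq j j0) => // nj.
    by rewrite (inj_eq Some_inj) (negbTE nj).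
  rewrite cP (big_pred1 i) // => j /=; rewrite /f; case: (eqVneq j j0) => [->|nj].
    by rewrite [RHS]eq_sym (negbTE nij).
  by rewrite (inj_eq Some_inj).
have demN : dem f (t * m) None = #|P j0|.
  rewrite cP /dem (big_pred1 tt); last by case.
  rewrite (big_pred1 j0) // => j /=.
  by rewrite /f; case: (eqVneq j j0).
have [l i j|l i j|[i|]|s [u [bs cs us]]] := @extended_move _ f t.
- by rewrite /f; case: (eqVneq i) => [->|_]; case: (eqVneq j) => // _ [].
- by rewrite /f; case: (eqVneq i j0) => // ni [<-] x y xX; apply: eX xX ni.
- by rewrite demS /=; case: ifP.
- by rewrite demN /= (leq_trans _ leX) // cP leq_mul2r part_size_le orbT.
move=> Ps; exists s; split=> //; apply: le_trans Ps.
have -> : (\sum_(j | dem f (t * m) (Some j) != #|P j|) \sum_(v in P j) c v =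
    \sum_(v in P j0) c v)%R.
  rewrite (big_pred1 j0) // => j /=; rewrite demS.
  case: (eqVneq j j0) => [->|]; last by rewrite eqxx.
  by rewrite eq_sym -lt0n P_gt0.
rewrite -addrA lerD2l lerBrDr.
have N0 : (0 < #|P j0|%:R :> R)%R by rewrite ltr0n P_gt0.
(* After multiplication by [#|P j0|], the covered weight of [X] can be compared with each [y] in
   [P j0] separately. *)
rewrite -(ler_pM2l N0).
have -> : (#|P j0|%:R * (\sum_(v in X) c v * (u v)%:R) =
    \sum_(y in P j0) \sum_(v in X) c v * (u v)%:R :> R)%R.
  by rewrite [RHS]sumr_const mulr_natl.
apply: le_trans (_ : (\sum_(y in P j0) (c y + g) * #|P j0|%:R <= _)%R); last first.
  apply: ler_sum => y yP; rewrite -demN -us natr_sum big_distrr /=.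
  by apply: ler_sum => x xX; rewrite ler_wpM2r ?ler0n ?gX.
rewrite -big_distrl /= mulrC ler_pM2r // big_split /= [leRHS]addrC lerD2r.
rewrite sumr_const -[leRHS]mulr_natr ler_wpM2l // ler_nat cP leq_pmull //.
by rewrite (leq_trans s0_gt0) ?part_size_ge.
Qed.

End Extended.
End Moves.

(** * Counting neighbours in a tiling *)

Lemma sum_cov_in (V : finType) (k : nat) (e : rel V) a m (s : seq (tile V k)) (A : {set V}) :
  irreflexive e -> bottles e a m s ->
  \sum_(v in A) cov s v = \sum_(T <- s) #|A :&: \bigcup_j T j|.
Proof.
move=> eI; elim: s => [|T s IH] bs.
  by rewrite [RHS]big_nil big1 // => v _; rewrite cov_nil.
under eq_bigr do rewrite cov_cons.
rewrite big_cons big_split /= IH; last by apply: sub_bottles bs => T'; rewrite inE orbC => ->.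
congr addn; rewrite -sum_mem; apply: eq_bigr => v _.
by rewrite (cov1E _ eI (bs T _)) ?mem_head.
Qed.

Lemma card_interval (V : finType) (I : V -> nat) t d :
  injective I -> #|[set v | t <= I v < t + d]| <= d.
Proof.
move=> I_inj; rewrite cardE -(size_map I) -[leqRHS](size_iota t).
apply: uniq_leq_size; first by rewrite map_inj_uniq ?enum_uniq.
by move=> _ /mapP[v + ->]; rewrite mem_enum inE mem_iota.
Qed.

Lemma pigeonhole_fibre (X Y : finType) (A : {set X}) (B : {set Y}) (f : X -> Y) L :
  {in A, forall x, f x \in B} -> #|B| * L < #|A| ->
  exists y, L <= #|[set x in A | f x == y]|.
Proof.
move=> fB BA; apply/existsP; apply: contraLR BA.
rewrite negb_exists -leqNgt => /forallP fL.
rewrite -[#|A|]sum1_card (partition_big f [in B]) //= -sum_nat_const.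
apply: leq_sum => y _; rewrite ltnW // ltnNge; apply: contra (fL y) => /leq_trans-> //.
by rewrite -[leqRHS]sum1_card; apply/eq_leq/eq_bigl => x; rewrite inE.
Qed.

(** With at least one wide part, the truncated subtractions are exact. *)
Lemma height_split k s0 w0 : 0 < k ->
  height k s0 w0 = (height k s0 w0 - s0 - w0) + s0 + w0.
Proof. by rewrite /height; case: k => // k' _; rewrite mulSn; lia. Qed.

Section Improve.
Variables (R : realFieldType) (V : finType) (k s0 w0 : nat).
Variables (e : rel V) (I : V -> nat).
Hypotheses (e_sym : symmetric e) (e_irr : irreflexive e).
Hypotheses (k_gt0 : 0 < k) (s0_gt0 : 0 < s0) (s0_le_w0 : s0 <= w0).
Hypothesis I_lt : forall v, I v < #|V|.

Let n := #|V|.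
Let h := height k s0 w0.
Let a : 'I_k.+1 -> nat := part_size s0 w0.

(* The slope is so small that covering one more vertex always outweighs the ranks. *)
Definition weight (v : V) : R := (1 - (2 * w0%:R)^-1 * ((I v)%:R / n%:R))%R.

Local Notation Phi := (@covered_weight R V k weight).

Lemma weight_le1 v : (weight v <= 1)%R.
Proof. by rewrite /weight gerBl !mulr_ge0 // ?invr_ge0 ?mulr_ge0 ?ler0n. Qed.

Lemma weight_ge v : (1 - (2 * w0%:R)^-1 <= weight v)%R.
Proof.
rewrite lerD2l lerN2 ler_piMr ?invr_ge0 ?mulr_ge0 ?ler0n //.
have n0 : 0 < n by apply: leq_ltn_trans (I_lt v).
by rewrite ler_pdivrMr ?ltr0n // mul1r ler_nat ltnW.
Qed.

Variables (m K Z : nat).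
Let p := k * (h - w0) * m.
Let M := K.+1 * p.

Definition nbr (x : V) := [set y | e x y].
Definition above (x : V) := [set y | I x + Z <= I y].

(* [N] are the neighbours of [x], [J] the vertices of rank at least [I x + Z]. *)
Definition useful (N J : {set V}) (T : tile V k) : bool :=
  [|| [forall i, w0 * p <= #|N :&: T i|],
      (s0 < w0) && [forall i, (i != ord0) ==> (w0 * p <= #|N :&: T i|)]
    | [exists j, (w0 * p <= #|J :&: T j|) &&
        [forall i, (i != j) ==> (w0 * p <= #|N :&: T i|)]]].

(** Call a part seen if [N] meets it in at least [w0 * p] vertices; unseen parts contribute only the
    error [k.+1 * (w0 * p)]. In a useless tile some unseen part has size [w0 * M], whence the first
    bound. If a second part is unseen, at least [s0 * M] more is missing. Otherwise [J] hardly meets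
    the only unseen part, so almost [w0 * M] vertices of the tile lie outside [J], and these pay for
    the second bound. *)
Lemma useless_bound (N J : {set V}) (T : tile V k) :
  bottle e a M T -> ~~ useful N J T ->
  #|N :&: \bigcup_j T j| <= (h - w0) * M + k.+1 * (w0 * p) /\
  w0 * #|N :&: \bigcup_j T j| <=
    w0 * ((h - s0 - w0) * M + k.+1 * (w0 * p)) +
    s0 * (#|(\bigcup_j T j) :\: J| + w0 * p).
Proof.
move=> bT; rewrite /useful !negb_or !negb_and => /and3P[/forallPn[i0 u0] uS uJ].
pose seen i := w0 * p <= #|N :&: T i|.
have hE : \sum_i a i = h by apply: sum_part_size.
have cardE' : #|N :&: \bigcup_j T j| = \sum_i #|N :&: T i|.
  have := sum_cov_in N e_irr (bottles1 bT); rewrite big_seq1 => <-.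
  rewrite (eq_bigr (fun v => \sum_j (v \in T j))) => [|v _]; last exact: cov1.
  by rewrite exchange_big; apply: eq_bigr => j _; apply: sum_mem.
have le_seen : #|N :&: \bigcup_j T j| <= (\sum_(i | seen i) a i) * M + k.+1 * (w0 * p).
  rewrite cardE' big_distrl /= [X in _ <= X + _]big_mkcond /=.
  have -> : k.+1 * (w0 * p) = \sum_(i < k.+1) w0 * p by rewrite sum_nat_const card_ord.
  rewrite -big_split /=.
  apply: leq_sum => i _; case: ifP => [_|/negbT]; last by rewrite -ltnNge => /ltnW.
  by rewrite (leq_trans _ (leq_addr _ _)) // -bT.1 subset_leq_card ?subsetIr.
(* If the neck is unseen and [s0 < w0], the failure of the second alternative gives an unseen wide
   part; if [s0 = w0], the neck itself has the right size. *)
have [i1 u1 ai1] : exists2 i1, ~~ seen i1 & a i1 = w0.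
  have [ai0|ai0] := eqVneq (a i0) w0; first by exists i0.
  have i00 : i0 = ord0 by apply/eqP; apply: contraNT ai0; rewrite /a /part_size => /negbTE->.
  have s0w : s0 < w0.
    by rewrite ltn_neqAle s0_le_w0 andbT; move: ai0; rewrite i00 /a /part_size eqxx.
  move: uS; rewrite s0w /= => /forallPn[i1]; rewrite negb_imply => /andP[ni1 ui1].
  by exists i1; rewrite // /a /part_size (negbTE ni1).
have seen1 : \sum_(i | seen i) a i + w0 <= h.
  rewrite -hE (bigID seen predT) /= leq_add2l (bigD1 i1) //= ai1; exact: leq_addr.
have hs := height_split s0 w0 k_gt0.
split.
  apply: leq_trans le_seen _; rewrite leq_add2r leq_mul2r; apply/orP; right; lia.
have [/existsP[i2 /andP[n21 u2]]|/existsPn only1] :=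
    boolP [exists i2, (i2 != i1) && ~~ seen i2].
  have : \sum_(i | seen i) a i + w0 + s0 <= h.
    rewrite -hE (bigID seen predT) /= -addnA leq_add2l (bigD1 i1) //= ai1 leq_add2l.
    rewrite (bigD1 i2) ?u2 //=; apply: leq_trans (leq_addr _ _).
    exact: part_size_ge.
  move=> le2; apply: leq_trans (leq_addr _ _); rewrite leq_mul2l; apply/orP; right.
  apply: leq_trans le_seen _; rewrite leq_add2r leq_mul2r; apply/orP; right; lia.
have cJ : #|J :&: T i1| < w0 * p.
  move/existsPn: uJ => /(_ i1); rewrite negb_and -ltnNge => /orP[//|/forallPn[i]].
  by rewrite negb_imply => /andP[n1 un]; have := only1 i; rewrite n1 un.
have cD : w0 * M <= #|(\bigcup_j T j) :\: J| + w0 * p.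
  rewrite -{1}ai1 -bT.1 -(cardsID J (T i1)) addnC leq_add //; last by rewrite setIC ltnW.
  by apply/subset_leq_card/setSD/bigcup_sup.
have := leq_mul (leqnn s0) cD; have := leq_mul (leqnn w0) le_seen.
have : w0 * ((\sum_(i | seen i) a i) * M) <= w0 * ((h - s0 - w0) * M) + s0 * (w0 * M).
  rewrite [s0 * _]mulnCA -mulnDr -mulnDl leq_mul2l leq_mul2r; apply/orP; right.
  apply/orP; right; lia.
rewrite !mulnDr; lia.
Qed.

Hypothesis m_gt0 : 0 < m.

Let gain : R := ((2 * w0%:R)^-1 * (Z%:R / n%:R))%R.

Lemma useful_move (T : tile V k) (X N J : {set V}) : Z <= n ->
  bottle e a M T -> [disjoint \bigcup_j T j & X] ->
  (forall x, x \in X -> nbr x :&: \bigcup_j T j = N) ->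
  (forall x, x \in X -> above x :&: \bigcup_j T j = J) ->
  useful N J T -> h * h * p <= #|X| ->
  exists s, [/\ bottles e a m s,
    forall v, cov s v <= (v \in (\bigcup_j T j) :|: X)
    & (Phi [:: T] + gain * p%:R <= Phi s)%R].
Proof.
move=> Zn bT dTX XN XJ uT leX.
have w0_gt0 : 0 < w0 by apply: leq_trans s0_le_w0.
have h_ge : 0 < h by rewrite /h /height addn_gt0 s0_gt0 orbT.
(* The first two moves gain [p / 2], which must be at least the gain of a swap. *)
have gain_le : (gain <= 1 / 2)%R.
  have w1 : (1 <= w0%:R :> R)%R by rewrite ler1n.
  have zn : (Z%:R / n%:R <= 1 :> R)%R.
    have [->|n0] := posnP n; first by rewrite invr0 mulr0 ler01.
    by rewrite ler_pdivrMr ?ltr0n // mul1r ler_nat.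
  rewrite /gain invfM -mulrA div1r ler_piMr ?invr_ge0 //.
  have wi : (w0%:R^-1 <= 1 :> R)%R by rewrite invf_le1 // (lt_le_trans _ w1).
  by apply: mulr_ile1 => //; rewrite ?mulr_ge0 ?invr_ge0 ?ler0n.
have hp : h * p <= #|X| by rewrite (leq_trans _ leX) // -mulnA leq_pmull.
have wp : w0 * p <= #|X|.
  apply: leq_trans hp; rewrite leq_mul2r; apply/orP; right.
  exact: leq_trans (leq_pmull _ k_gt0) (leq_addr _ _).
have eN x y : x \in X -> y \in N -> e x y.
  by move=> xX; rewrite -(XN x xX) !inE => /andP[].
have aw j : a j * p <= w0 * p by rewrite leq_mul2r (part_size_le s0_le_w0) orbT.
have pickP (F : 'I_k.+1 -> {set V}) : (forall j, a j * p <= #|F j :&: T j|) ->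
    exists P : 'I_k.+1 -> {set V}, [/\ forall j, P j \subset T j,
      forall j, #|P j| = a j * p & forall j, P j \subset F j].
  move=> leF; have ex j := subset_card (leF j).
  have P_ex j : {B : {set V} | (B \subset F j :&: T j) && (#|B| == a j * p)}.
    by apply: sigW; have [B BF /eqP cB] := ex j; exists B; rewrite BF.
  exists (fun j => sval (P_ex j)); split=> j;
    case: (P_ex j) => B /= /andP[]; rewrite subsetI => /andP[] // ? ? /eqP.
  by [].
have lift_gain s : (Phi [:: T] + p%:R / 2 <= Phi s)%R ->
    (Phi [:: T] + gain * p%:R <= Phi s)%R.
  apply: le_trans; rewrite lerD2l mulrC ler_wpM2l //; lra.
case/or3P: uT => [/forallP uT|/andP[sw /forallP uT]|/existsP[j /andP[uJ /forallP uT]]].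
- have [//|P [PT cP PF]] := pickP (fun=> N); first by move=> j; apply: leq_trans (uT j).
  have [x j y xX yP| |s [bs cs Ps]] := @full_move R V k s0 w0 e weight e_sym e_irr
    k_gt0 s0_gt0 s0_le_w0 weight_ge m K T P X bT dTX PT cP.
  + by apply: eN => //; apply: (subsetP (PF j)).
  + exact: hp.
  + by exists s; split=> //; apply: lift_gain.
(* The neck is to be given up, so it is chosen without regard to [N]. *)
- have [j|P [PT cP PF]] := pickP (fun j => if j == ord0 then setT else N).
    case: eqP => [->|/eqP nj]; first by rewrite setTI (bT.1) leq_mul2l leq_pmull ?orbT.
    by apply: leq_trans (aw j) _; have := uT j; rewrite nj.
  have [x j y xX nj yP| |s [bs cs Ps]] := @neck_move R V k s0 w0 e weight e_sym e_irr
    k_gt0 s0_gt0 s0_le_w0 weight_le1 weight_ge m K T P X m_gt0 bT dTX PT cP sw.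
  + by apply: eN => //; have := subsetP (PF j) y yP; rewrite (negbTE nj).
  + exact: leX.
  + by exists s; split=> //; apply: lift_gain.
- have [i|P [PT cP PF]] := pickP (fun i => if i == j then J else N).
    case: eqP => [->|/eqP nj]; first by apply: leq_trans uJ.
    by apply: leq_trans (aw i) _; have := uT i; rewrite nj.
  have [| | | |s [bs cs Ps]] := @swap_move R V k s0 w0 e weight e_sym e_irr
    k_gt0 s0_gt0 s0_le_w0 weight_ge m K T P X m_gt0 bT dTX PT cP j gain.
  + by rewrite /gain !mulr_ge0 // ?invr_ge0 ?mulr_ge0 ?ler0n.
  + move=> x i y xX ni yP.
    by apply: eN => //; have := subsetP (PF i) y yP; rewrite (negbTE ni).
  + move=> x y xX yP; have := subsetP (PF j) y yP; rewrite eqxx -(XJ x xX) !inE.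
    case/andP => Zxy _; rewrite /weight /gain -addrA lerD2l.
    have kap0 : (0 <= (2 * w0%:R)^-1 :> R)%R by rewrite invr_ge0 mulr_ge0 ?ler0n.
    have : ((I x)%:R / n%:R + Z%:R / n%:R <= (I y)%:R / n%:R :> R)%R.
      by rewrite -mulrDl ler_wpM2r ?invr_ge0 ?ler0n // -natrD ler_nat.
    by move=> /(ler_wpM2l kap0); rewrite mulrDr; lra.
  + exact: wp.
  + by exists s.
Qed.

End Improve.

(** * Arithmetic of the degree condition *)

Section MassInequalities.
Local Open Scope ring_scope.

(** Here [S] tiles have level [K P], [N] is a degree, [D] the number of neighbours inside the
    tiling, and [U] the total size of the useful tiles. Of the surplus [eta n], at most [eta n / 4]
    is spent on uncovered vertices and [eta n / 8] on the thresholds in useless tiles. *)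
Lemma mass_ineq_high (R : realFieldType) (n h w s B N S A K P D U eta : R) :
  0 <= n -> 0 <= s -> 0 <= B -> 0 <= S -> 0 <= P -> 1 <= h ->
  B + s + w = h ->
  (B + s) * n + eta * (h * n) <= h * N ->
  N + S * (h * (K * P)) <= D + n ->
  S * (h * (K * P)) <= n ->
  n - S * (h * (K * P)) <= eta / 4 * n ->
  D <= U + S * ((B + s) * (K * P) + A * (w * P)) ->
  A * w + s <= eta / 8 * (h * K) -> 0 < eta ->
  eta / 2 * n <= U.
Proof.
move=> n0 s0 B0 S0 P0 h1 hE d1 dD sz sn b1 KB e0.
have h0 : 0 < h by lra.
have SP : 0 <= S * P by apply: mulr_ge0.
have f1 : (B + s) * (S * (h * (K * P))) <= (B + s) * n by apply: ler_wpM2l => //; apply: addr_ge0.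
have f2 : (A * w + s) * (S * P) <= eta / 8 * n.
  apply: le_trans (ler_wpM2r SP KB) _.
  apply: le_trans (_ : eta / 8 * (S * (h * (K * P))) <= _); last first.
    by apply: ler_wpM2l => //; lra.
  by rewrite le_eqVlt; apply/orP; left; apply/eqP; ring.
have f3 : 0 <= s * (S * P) by apply: mulr_ge0.
have f4 : h * D <= h * (U + S * ((B + s) * (K * P) + A * (w * P))) by rewrite ler_pM2l.
have f5 : h * (N + S * (h * (K * P))) <= h * (D + n) by rewrite ler_pM2l.
have f6 : h * ((A * w) * (S * P)) <= h * (eta / 8 * n) by rewrite ler_pM2l //; lra.
have f7 : h * (n - S * (h * (K * P))) <= h * (eta / 4 * n) by rewrite ler_pM2l.
have f8 : 0 <= h * (eta * n) by rewrite !mulr_ge0 //; lra.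
rewrite -(ler_pM2l h0); lra.
Qed.

(** As for [mass_ineq_high], with a further [eta n / 8] spent on the rank shift [z]; this leaves
    exactly [eta n / 2]. *)
Lemma mass_ineq_low (R : realFieldType) (n h w s B N S A K P D U i z eta : R) :
  0 <= n -> 0 <= s -> 0 <= B -> 0 <= S -> 0 <= P -> 1 <= h -> 1 <= w -> s <= w ->
  w * B * n + s * h * i + eta * (w * h * n) <= w * h * N ->
  N + S * (h * (K * P)) <= D + n ->
  S * (h * (K * P)) <= n ->
  n - S * (h * (K * P)) <= eta / 4 * n ->
  w * D <= w * U + S * (w * (B * (K * P) + A * (w * P)) + s * (w * P)) + s * (i + z) ->
  A * w + s <= eta / 8 * (h * K) -> z <= eta / 8 * n -> 0 < eta ->
  eta / 2 * n <= U.
Proof.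
move=> n0 s0 B0 S0 P0 h1 w1 sw d1 dD sz sn b1 KB zB e0.
have h0 : 0 < h by lra.
have w0 : 0 < w by lra.
have wh0 : 0 < w * h by apply: mulr_gt0.
have SP : 0 <= S * P by apply: mulr_ge0.
have f1 : w * B * (S * (h * (K * P))) <= w * B * n.
  by apply: ler_wpM2l => //; apply: mulr_ge0 => //; lra.
have f2 : (A * w + s) * (S * P) <= eta / 8 * n.
  apply: le_trans (ler_wpM2r SP KB) _.
  apply: le_trans (_ : eta / 8 * (S * (h * (K * P))) <= _); last first.
    by apply: ler_wpM2l => //; lra.
  by rewrite le_eqVlt; apply/orP; left; apply/eqP; ring.
have f4 := ler_wpM2l (ltW h0) b1.
have f5 := ler_wpM2l (ltW wh0) dD.
have f6 := ler_wpM2l (ltW wh0) f2.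
have f7 := ler_wpM2l (ltW wh0) sn.
have f8 : 0 <= w * h * (eta * n) by rewrite !mulr_ge0 //; lra.
have f9 : s * z <= w * (eta / 8 * n).
  apply: le_trans (ler_wpM2l s0 zB) _; apply: ler_wpM2r => //.
  by apply: mulr_ge0 => //; lra.
have f10 := ler_wpM2l (ltW h0) f9.
rewrite -(ler_pM2l wh0); lra.
Qed.

End MassInequalities.

Lemma card_le_cov (V : finType) (k : nat) (s : seq (tile V k)) (A : {set V}) :
  (forall v, cov s v <= 1) -> \sum_(v in A) cov s v <= #|A|.
Proof. by move=> c1; rewrite -sum1_card; apply: leq_sum. Qed.

(* The degree condition multiplied through by the denominators [height] and [w0]:
   with [h = height], the two clauses say [deg x >= (1 - w0 / h) n + eta n] and
   [deg x >= (1 - (s0 + w0) / h) n + (s0 / w0) (I x) + eta n]. *)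
Definition degree_cond (R : realFieldType) (V : finType) (k s0 w0 : nat)
    (e : rel V) (I : V -> nat) (eta : R) : Prop :=
  let h := height k s0 w0 in let n := #|V| in
  forall x,
    (w0 * n <= h * I x ->
      (((h - w0) * n)%:R + eta * (h * n)%:R <= (h * #|nbr e x|)%:R)%R) /\
    (h * I x <= w0 * n ->
      ((w0 * (h - s0 - w0) * n + s0 * h * I x)%:R + eta * (w0 * h * n)%:R
        <= (w0 * h * #|nbr e x|)%:R)%R).

Section UsefulMass.
Variables (R : realFieldType) (V : finType) (k s0 w0 : nat).
Variables (e : rel V) (I : V -> nat) (eta : R).
Hypothesis e_irr : irreflexive e.
Hypotheses (k_gt0 : 0 < k) (s0_gt0 : 0 < s0) (s0_le_w0 : s0 <= w0).
Hypothesis I_inj : injective I.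
Hypotheses (eta_gt0 : (0 < eta)%R) (deg : degree_cond k s0 w0 e I eta).

Let n := #|V|.
Let h := height k s0 w0.
Let a : 'I_k.+1 -> nat := part_size s0 w0.

Variables (m K Z : nat).
Let p := k * (h - w0) * m.
Let M := K.+1 * p.
Hypothesis K_big : ((k.+1 * w0 + s0)%:R <= eta / 8 * (h * K.+1)%:R)%R.
Hypothesis Z_small : (Z%:R <= eta / 8 * n%:R)%R.

(** Summing [useless_bound] over the tiles, with useful tiles counted in full, bounds the neighbours
    of [x] in the tiling from above; the degree condition bounds them from below. High ranks use the
    first bound. Low ranks use the second, where at most [I x + Z] vertices lie outside [J] because
    ranks are distinct. *)
Lemma useful_mass (s : seq (tile V k)) (x : V) :
  bottles e a M s -> (forall v, cov s v <= 1) ->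
  (n%:R - (size s * (h * M))%:R <= eta / 4 * n%:R)%R ->
  (eta / 2 * n%:R <= \sum_(T <- s) (useful s0 w0 m (nbr e x) (above I Z x) T * (h * M))%:R)%R.
Proof.
move=> bs cs sn; set N := nbr e x; set J := above I Z x.
set U := (\sum_(T <- s) _)%R.
pose D := \sum_(T <- s) #|N :&: \bigcup_j T j|.
have w0_gt0 : 0 < w0 by apply: leq_trans s0_le_w0.
have h_gt0 : 0 < h by rewrite /h /height addn_gt0 s0_gt0 orbT.
have aE : \sum_i a i = h by apply: sum_part_size.
have szn : size s * (h * M) <= n.
  rewrite -aE -(sum_cov bs) /n -sum1_card; exact: leq_sum.
have degD : #|N| + size s * (h * M) <= D + n.
  rewrite /D -(sum_cov_in N e_irr bs) -aE -(sum_cov bs) (bigID [in N] predT) /=.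
  rewrite addnCA leq_add2l /n -(cardsC N) leq_add2l.
  rewrite (eq_bigl [in ~: N]) => [|v]; last by rewrite in_setC.
  exact: card_le_cov.
have hM (T : tile V k) : T \in s -> #|N :&: \bigcup_j T j| <= h * M.
  by move=> /bs bT; rewrite -aE -(card_bottle e_irr bT) subset_leq_card ?subsetIr.
have bound1 : D <= \sum_(T <- s) useful s0 w0 m N J T * (h * M)
     + size s * ((h - w0) * M + k.+1 * (w0 * p)).
  rewrite -[size s]sum1_size big_distrl /= -big_split /=.
  rewrite /D big_seq [leqRHS]big_seq; apply: leq_sum => T sT.
  case: (boolP (useful _ _ _ _ _ _)) => [_|uT].
    by rewrite /= !mul1n; apply: leq_trans (hM T sT) (leq_addr _ _).
  rewrite /= mul0n add0n mul1n.
  by apply: (useless_bound e_irr k_gt0 s0_gt0 s0_le_w0 (bs T sT) uT).1.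
have bound2 : w0 * D <= w0 * \sum_(T <- s) useful s0 w0 m N J T * (h * M)
     + size s * (w0 * ((h - s0 - w0) * M + k.+1 * (w0 * p)) + s0 * (w0 * p))
     + s0 * (I x + Z).
  have leJ : \sum_(T <- s) #|(\bigcup_j T j) :\: J| <= I x + Z.
    have -> : \sum_(T <- s) #|(\bigcup_j T j) :\: J| = \sum_(v in ~: J) cov s v.
      by rewrite (sum_cov_in _ e_irr bs); apply: eq_bigr => T _; rewrite setDE setIC.
    apply: leq_trans (card_le_cov _ cs) _; apply: leq_trans (card_interval 0 _ I_inj).
    by apply: subset_leq_card; apply/subsetP => v; rewrite !inE ltnNge.
  suff le2 : w0 * D <= w0 * \sum_(T <- s) useful s0 w0 m N J T * (h * M)
      + size s * (w0 * ((h - s0 - w0) * M + k.+1 * (w0 * p)) + s0 * (w0 * p))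
      + s0 * \sum_(T <- s) #|(\bigcup_j T j) :\: J|.
    by apply: leq_trans le2 _; rewrite leq_add2l leq_mul2l leJ orbT.
  rewrite -[size s]sum1_size !big_distrl !big_distrr /=.
  rewrite -!big_split /= big_seq [leqRHS]big_seq; apply: leq_sum => T sT.
  case: (boolP (useful _ _ _ _ _ _)) => [_|uT].
    by rewrite /= !mul1n -addnA (leq_trans _ (leq_addr _ _)) // leq_mul2l hM ?orbT.
  have := (useless_bound e_irr k_gt0 s0_gt0 s0_le_w0 (bs T sT) uT).2.
  by rewrite /= mul0n muln0 add0n mul1n -addnA -mulnDr [w0 * p + _]addnC.
have [d1 d2] := deg x.
have hs : h = (h - s0 - w0) + s0 + w0 by apply: height_split.
have UE : (U = (\sum_(T <- s) useful s0 w0 m N J T * (h * M))%:R)%R.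
  by rewrite natr_sum.
set Un := \sum_(T <- s) useful s0 w0 m N J T * (h * M) in bound1 bound2 UE.
have hw : h - w0 = (h - s0 - w0) + s0 by rewrite {1}hs addnK.
have hR : ((h - s0 - w0)%:R + s0%:R + w0%:R = h%:R :> R)%R by rewrite -!natrD -hs.
have degR : (#|N|%:R + (size s)%:R * (h%:R * (K.+1%:R * p%:R)) <= D%:R + n%:R :> R)%R.
  by rewrite -!natrM -!natrD ler_nat.
have szR : ((size s)%:R * (h%:R * (K.+1%:R * p%:R)) <= n%:R :> R)%R.
  by rewrite -!natrM ler_nat.
have snR : (n%:R - (size s)%:R * (h%:R * (K.+1%:R * p%:R)) <= eta / 4 * n%:R)%R.
  by rewrite -!natrM.
have KR : (k.+1%:R * w0%:R + s0%:R <= eta / 8 * (h%:R * K.+1%:R))%R.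
  by rewrite -!natrM -natrD.
rewrite UE; have [hi|lo] := leqP (w0 * n) (h * I x).
  apply: (@mass_ineq_high R n%:R h%:R w0%:R s0%:R (h - s0 - w0)%:R #|N|%:R (size s)%:R
    k.+1%:R K.+1%:R p%:R D%:R)%R; rewrite ?ler0n ?ler1n //.
    by rewrite -natrD -!natrM -hw; apply: d1.
  by rewrite -!(natrD, natrM) -hw ler_nat.
apply: (@mass_ineq_low R n%:R h%:R w0%:R s0%:R (h - s0 - w0)%:R #|N|%:R (size s)%:R
    k.+1%:R K.+1%:R p%:R D%:R _ (I x)%:R Z%:R)%R; rewrite ?ler0n ?ler1n ?ler_nat //.
  by rewrite -!(natrD, natrM); apply: d2; apply: ltnW.
by rewrite -!(natrD, natrM) ler_nat.
Qed.

End UsefulMass.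

(** * A single improvement of the tiling *)

Section ImproveOne.
Variables (R : realFieldType) (V : finType) (k s0 w0 : nat).
Variables (e : rel V) (I : V -> nat) (eta : R).
Hypotheses (e_sym : symmetric e) (e_irr : irreflexive e).
Hypotheses (k_gt0 : 0 < k) (s0_gt0 : 0 < s0) (s0_le_w0 : s0 <= w0).
Hypotheses (I_inj : injective I) (I_lt : forall v, I v < #|V|).
Hypotheses (eta_gt0 : (0 < eta)%R) (deg : degree_cond k s0 w0 e I eta).

Let n := #|V|.
Let h := height k s0 w0.
Let a : 'I_k.+1 -> nat := part_size s0 w0.
Local Notation Phi := (@covered_weight R V k (weight R w0 I)).

Variables (m K Z : nat).
Let p := k * (h - w0) * m.
Let M := K.+1 * p.
Hypothesis m_gt0 : 0 < m.
Hypothesis K_big : ((k.+1 * w0 + s0)%:R <= eta / 8 * (h * K.+1)%:R)%R.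
Hypothesis Z_small : (Z%:R <= eta / 8 * n%:R)%R.

Let gain : R := ((2 * w0%:R)^-1 * (Z%:R / n%:R))%R.

(** Double counting of the pairs of a vertex of [U] and a tile useful for it, weighted by the size
    [h * M] of a tile. *)
Lemma popular_tile (eps : R) (s : seq (tile V k)) (U : {set V}) (L : nat) :
  bottles e a M s -> (forall v, cov s v <= 1) ->
  (n%:R - (size s * (h * M))%:R <= eta / 4 * n%:R)%R ->
  (eps * n%:R < #|U|%:R)%R -> (L%:R <= eta / 2 * (eps * n%:R))%R ->
  exists2 T, T \in s & L < #|[set x in U | useful s0 w0 m (nbr e x) (above I Z x) T]|.
Proof.
move=> bs cs sn epsU Leps.
case: (boolP (has (fun T => L < #|[set x in U | useful s0 w0 m (nbr e x) (above I Z x) T]|) s)).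
  by case/hasP => T; exists T.
rewrite -all_predC => /allP /= few; exfalso.
have aE : \sum_i a i = h by apply: sum_part_size.
have szn : size s * (h * M) <= n.
  by rewrite -aE -(sum_cov bs) /n -sum1_card; apply: leq_sum.
have le1 : (#|U|%:R * (eta / 2 * n%:R) <= n%:R * L%:R :> R)%R.
  apply: le_trans (_ : (\sum_(x in U) \sum_(T <- s)
      (useful s0 w0 m (nbr e x) (above I Z x) T * (h * M))%:R <= _)%R).
    rewrite mulr_natl -sumr_const; apply: ler_sum => x _.
    exact: (useful_mass e_irr k_gt0 s0_gt0 s0_le_w0 I_inj eta_gt0 deg K_big Z_small).
  rewrite exchange_big /= -natrM.
  apply: le_trans (_ : ((size s * (h * M) * L)%:R <= _)%R); last first.
    by rewrite ler_nat leq_mul2r szn orbT.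
  under eq_bigr do rewrite -natr_sum.
  rewrite -natr_sum ler_nat -mulnA -[size s]sum1_size big_distrl /=.
  rewrite big_seq [leqRHS]big_seq; apply: leq_sum => T sT.
  rewrite -big_distrl /= mul1n mulnC leq_mul2l; apply/orP; right.
  have := few T sT; rewrite -leqNgt; apply: leq_trans.
  rewrite -sum1_card.
  rewrite [leqRHS](eq_bigl (fun x =>
    (x \in U) && useful s0 w0 m (nbr e x) (above I Z x) T)) => [|x]; last by rewrite inE.
  by rewrite -big_mkcondr /= leq_eqVlt; apply/orP; left; apply/eqP; apply: eq_bigr => x _.
have n_gt0 : (0 < n%:R :> R)%R.
  rewrite ltr0n lt0n; apply: contraTneq epsU => n0.
  have -> : #|U| = 0 by apply/eqP; rewrite -leqn0 -n0 max_card.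
  by rewrite n0 mulr0 ltxx.
have := ltr_pM2l (mulr_gt0 (divr_gt0 eta_gt0 (ltr0n R 2)) n_gt0) (eps * n%:R)%R #|U|%:R%R.
rewrite epsU => le2.
have := ler_wpM2l (ltW n_gt0) Leps; lra.
Qed.

(** The tiles of [s1] still have the large level [M], those of [s2] already have level [m]. One tile
    of [s1] is used up, and the bottles that replace it join [s2]. *)
Lemma improve_one (eps : R) (s1 s2 : seq (tile V k)) : Z <= n ->
  let U := [set v | cov (s1 ++ s2) v == 0] in
  bottles e a M s1 -> bottles e a m s2 -> (forall v, cov (s1 ++ s2) v <= 1) ->
  (n%:R - (size s1 * (h * M))%:R <= eta / 4 * n%:R)%R ->
  (eps * n%:R < #|U|%:R)%R ->
  ((4 ^ (h * M) * (h * h * p))%:R <= eta / 2 * (eps * n%:R))%R ->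
  exists s1' s2', [/\ bottles e a M s1', bottles e a m s2',
    forall v, cov (s1' ++ s2') v <= 1, size s1 = (size s1').+1
    & (Phi (s1 ++ s2) + gain * p%:R <= Phi (s1' ++ s2'))%R].
Proof.
move=> Zn U b1 b2 c12 sn epsU Leps.
have c1 v : cov s1 v <= 1 by apply: leq_trans (c12 v); rewrite cov_cat leq_addr.
have [T Ts popT] := popular_tile b1 c1 sn epsU Leps.
have bT := b1 T Ts; set VT := \bigcup_j T j.
have aE : \sum_i a i = h by apply: sum_part_size.
(* The trace of [x] on the tile consists of two subsets of its [h * M] vertices: the neighbours of
   [x], and the vertices of rank at least [I x + Z]. *)
have cB : #|setX (powerset VT) (powerset VT)| = 4 ^ (h * M).
  by rewrite cardsX card_powerset (card_bottle e_irr bT) aE -expnMn.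
rewrite -cB in popT.
have [x _|[N J] leX] := pigeonhole_fibre
    (f := fun x => (nbr e x :&: VT, above I Z x :&: VT)) _ popT.
  by rewrite inE /= !powersetE !subsetIr.
set X := [set x in _ | _] in leX.
have XU x : x \in X -> [/\ cov (s1 ++ s2) x = 0, nbr e x :&: VT = N,
    above I Z x :&: VT = J & useful s0 w0 m (nbr e x) (above I Z x) T].
  rewrite in_set => /andP[]; rewrite in_set => /andP[]; rewrite in_set => /eqP c0 ux.
  by case/eqP.
have covT v : cov s1 v = cov [:: T] v + cov (rem T s1) v.
  by rewrite (cov_perm v (perm_to_rem Ts)) -cov_cons.
have cT v : cov [:: T] v = (v \in VT) by apply: cov1E bT.
have dTX : [disjoint VT & X].
  rewrite -setI_eq0; apply/eqP/setP => v; rewrite in_setI in_set0; apply/negP.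
  by case/andP => vT /XU[]; rewrite cov_cat covT cT vT.
have p_gt0 : 0 < p.
  rewrite /p !muln_gt0 k_gt0 m_gt0 /= andbT subn_gt0 /h height_split //.
  by rewrite -addnA -[X in X < _]add0n -addSn addnA leq_add2r ltn_addl.
have [x0 x0X] : exists x, x \in X.
  apply/card_gt0P; apply: leq_trans leX; rewrite muln_gt0 p_gt0 andbT muln_gt0 andbb.
  by rewrite /h /height addn_gt0 s0_gt0 orbT.
have uT : useful s0 w0 m N J T.
  have [_ <- <- ] := XU x0 x0X.
  have IT (B : {set V}) i : B :&: VT :&: T i = B :&: T i.
    by rewrite -setIA (setIidPr (_ : T i \subset VT)) //; apply: bigcup_sup.
  rewrite /useful => /or3P[/forallP u|/andP[-> /forallP u]|/existsP[j /andP[uj /forallP u]]].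
  - by apply/or3P/Or31; apply/forallP => i; rewrite IT.
  - by apply/or3P/Or32; apply/forallP => i; rewrite IT.
  - apply/or3P/Or33; apply/existsP; exists j; rewrite IT uj /=.
    by apply/forallP => i; rewrite IT.
have [||s [bs cs Ps]] := useful_move R e_sym e_irr k_gt0 s0_gt0 s0_le_w0 I_lt m_gt0 Zn bT
    dTX _ _ uT leX.
- by move=> x /XU[].
- by move=> x /XU[].
exists (rem T s1), (s ++ s2); split.
- by apply: sub_bottles b1; apply: mem_rem.
- exact: bottles_cat.
- move=> v; rewrite !cov_cat; have := cs v; have := c12 v; rewrite cov_cat covT cT inE.
  have := XU v; have : ~~ ((v \in VT) && (v \in X)).
    by apply/negP => /andP[vT vX]; have := disjointFr dTX vT; rewrite vX.
  case: (v \in VT) => /=; case: (v \in X) => //= _.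
  + by move=> _; clear; lia.
  + by move=> /(_ isT)[+ _ _ _]; rewrite cov_cat covT; clear; lia.
  + by move=> _; clear; lia.
- by rewrite size_rem // prednK //; case: (s1) Ts.
- rewrite !covered_weight_cat; have -> : Phi s1 = Phi ([:: T] ++ rem T s1).
    by apply: eq_covered_weight => v; rewrite covT cov_cat.
  rewrite -/gain in Ps; rewrite covered_weight_cat.
  rewrite -[(_ * m)%N]/p in Ps; move: (gain * p%:R)%R Ps => g; lra.
Qed.

End ImproveOne.

(** * Iterated improvement *)

Section Uncovered.
Variables (V : finType) (k : nat).
Implicit Types (s : seq (tile V k)) (e : rel V).

Definition uncovered s : {set V} := [set v | cov s v == 0].

Definition tiling e a m s := bottles e a m s /\ forall v, cov s v <= 1.

Lemma eq_uncovered s1 s2 : cov s1 =1 cov s2 -> uncovered s1 = uncovered s2.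
Proof. by move=> c12; apply/setP => v; rewrite !inE c12. Qed.

Lemma card_uncovered e a m s :
  tiling e a m s -> #|uncovered s| + size s * ((\sum_j a j) * m) = #|V|.
Proof.
move=> [bs c1]; rewrite -(sum_cov bs) -(cardsC (uncovered s)); congr addn.
rewrite -sum1_card [RHS]big_mkcond; apply: eq_bigr => v _ /=.
by rewrite !inE; have := c1 v; case: (cov s v) => [|[]].
Qed.

End Uncovered.

Section Rounds.
Variables (R : realFieldType) (V : finType) (k s0 w0 : nat).
Variables (e : rel V) (I : V -> nat) (eta : R).
Hypotheses (e_sym : symmetric e) (e_irr : irreflexive e).
Hypotheses (k_gt0 : 0 < k) (s0_gt0 : 0 < s0) (s0_le_w0 : s0 <= w0).
Hypotheses (I_inj : injective I) (I_lt : forall v, I v < #|V|).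
Hypotheses (eta_gt0 : (0 < eta)%R) (deg : degree_cond k s0 w0 e I eta).

Let n := #|V|.
Let h := height k s0 w0.
Let a : 'I_k.+1 -> nat := part_size s0 w0.
Local Notation Phi := (@covered_weight R V k (weight R w0 I)).

Definition total_weight : R := (\sum_v weight R w0 I v)%R.

(** The deficit is the total weight of the uncovered vertices, each of weight between [1/2] and [1];
    so the potential and the number of uncovered vertices control each other up to a factor [2]. *)
Lemma deficit_le (s : seq (tile V k)) : (forall v, cov s v <= 1) ->
  (total_weight - Phi s <= #|uncovered s|%:R)%R.
Proof.
move=> c1; rewrite -sumrB -sum1_card natr_sum [leRHS]big_mkcond /=.
apply: ler_sum => v _; rewrite inE; have := c1 v; case: (cov s v) => [|[]] //= _.
  by rewrite mulr0 subr0 weight_le1.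
by rewrite mulr1 subrr.
Qed.

Lemma deficit_ge (s : seq (tile V k)) : (forall v, cov s v <= 1) ->
  (#|uncovered s|%:R / 2 <= total_weight - Phi s)%R.
Proof.
move=> c1; rewrite -sumrB -sum1_card natr_sum [X in (X / _)%R]big_mkcond /=.
rewrite big_distrl; apply: ler_sum => v _ /=; rewrite inE.
have := c1 v; case: (cov s v) => [|[]] //= _; last by rewrite mulr1 subrr mul0r.
rewrite mulr0 subr0; apply: (c_ge_half s0_gt0 s0_le_w0) => u; exact: weight_ge.
Qed.

Variables (m K Z : nat).
Let p := k * (h - w0) * m.
Let M := K.+1 * p.
Hypothesis m_gt0 : 0 < m.
Hypothesis K_big : ((k.+1 * w0 + s0)%:R <= eta / 8 * (h * K.+1)%:R)%R.
Hypothesis Z_small : (Z%:R <= eta / 8 * n%:R)%R.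

Let gain : R := ((2 * w0%:R)^-1 * (Z%:R / n%:R))%R.

Lemma refine_tiling (s1 s2 : seq (tile V k)) :
  bottles e a M s1 -> bottles e a m s2 -> (forall v, cov (s1 ++ s2) v <= 1) ->
  exists2 s, tiling e a m s & cov s =1 cov (s1 ++ s2).
Proof.
rewrite /M /p mulnA => b1 b2 c12; have [s b c] := split_bottles e_irr b1.
have cE : cov (s ++ s2) =1 cov (s1 ++ s2) by move=> v; rewrite !cov_cat c.
by exists (s ++ s2) => //; split=> [|v]; [apply: bottles_cat|rewrite cE].
Qed.

(** At most [q] tiles of level [M] are used up, so the remaining ones miss at most [eta / 4 * n]
    vertices throughout, and [improve_one] keeps applying as long as more than [eps * n] vertices
    are uncovered. *)
Lemma improve_many (eps : R) (s : seq (tile V k)) q : Z <= n ->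
  tiling e a M s -> (#|uncovered s|%:R + (q * (h * M))%:R <= eta / 4 * n%:R)%R ->
  ((4 ^ (h * M) * (h * h * p))%:R <= eta / 2 * (eps * n%:R))%R ->
  exists2 s', tiling e a m s' &
    (#|uncovered s'|%:R <= eps * n%:R)%R \/ (Phi s + gain * p%:R * q%:R <= Phi s')%R.
Proof.
move=> Zn [bs cs] sq Leps.
have aE : \sum_i a i = h by apply: sum_part_size.
suff [//|[s1 [s2 [b1 b2 c12 _ Ps]]]] :
    (exists2 s', tiling e a m s' & (#|uncovered s'|%:R <= eps * n%:R)%R) \/
    (exists s1 s2, [/\ bottles e a M s1, bottles e a m s2,
      forall v, cov (s1 ++ s2) v <= 1, size s = size s1 + q
      & (Phi s + gain * p%:R * q%:R <= Phi (s1 ++ s2))%R]).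
- by case=> s' t' u'; exists s' => //; left.
- have [s' t' c'] := refine_tiling b1 b2 c12; exists s' => //; right.
  by have -> : Phi s' = Phi (s1 ++ s2) by apply: eq_covered_weight.
elim: q sq => [|q IH] sq.
  right; exists s, [::]; split; rewrite ?cats0 ?addn0 //; last by rewrite mulr0 addr0.
have [|[s' t' u']|[s1 [s2 [b1 b2 c12 sz Ps]]]] := IH.
- apply: le_trans sq; rewrite lerD2l ler_nat leq_mul2r leqnSn orbT //.
- by left; exists s'.
have [small|big] := lerP #|uncovered (s1 ++ s2)|%:R (eps * n%:R)%R.
  left; have [s' t' c'] := refine_tiling b1 b2 c12; exists s' => //.
  by rewrite (eq_uncovered c').
have [|s1' [s2' [b1' b2' c12' sz' Ps']]] := improve_one e_sym e_irr k_gt0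
  s0_gt0 s0_le_w0 I_inj I_lt eta_gt0 deg m_gt0 K_big Z_small Zn b1 b2 c12 _ big Leps.
  have := card_uncovered (conj bs cs); rewrite aE sz mulnDl => /(congr1 (fun i => i%:R : R)%R).
  rewrite !natrD -/n => nE; apply: le_trans sq.
  have : ((q * (h * M))%:R <= (q.+1 * (h * M))%:R :> R)%R by rewrite ler_nat leq_mul2r leqnSn orbT.
  rewrite -/h -/p -/M in nE *; lra.
right; exists s1', s2'; split=> //; first by rewrite sz sz' addSnnS.
apply: le_trans Ps'; rewrite -natr1 mulrDr mulr1 addrA lerD2r //.
Qed.

End Rounds.

(** * Surplus edges *)

Section Trim.
Variables (V : finType) (k : nat) (e e' : rel V) (a : 'I_k.+1 -> nat) (Z : {set V}).
Hypotheses (e_irr : irreflexive e) (e'_irr : irreflexive e').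
Hypothesis a_gt0 : forall j, 0 < a j.
Hypothesis e'e : forall x y, x \notin Z -> y \notin Z -> e' x y -> e x y.

(** All parts shrink in proportion: the level drops by [z] and is then rounded down to a multiple of
    [m]. As [a j >= 1], this leaves room in each part to avoid its at most [z] vertices of [Z]. *)
Lemma trim_bottle m Q (T : tile V k) : 0 < m -> bottle e' a (Q * m) T ->
  exists s, [/\ bottles e a m s, forall v, cov s v <= cov [:: T] v
    & \sum_v cov [:: T] v <=
        \sum_v cov s v + (\sum_j a j) * (#|Z :&: \bigcup_j T j| + m)].
Proof.
move=> m_gt0 bT; set z := #|_ :&: _|; set t := (Q * m - z) %/ m.
have tm : t * m <= Q * m - z by apply: leq_trunc_div.
have tm' : Q * m <= t * m + (z + m).
  have := ltn_ceil (Q * m - z) m_gt0; rewrite -/t mulSn; clear; lia.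
have ex j : exists B : {set V}, (B \subset T j :\: Z) && (#|B| == a j * (t * m)).
  have [|B BT cB] := @subset_card V (T j :\: Z) (a j * (t * m)).
    have zj : #|T j :&: Z| <= z.
      by rewrite setIC subset_leq_card // setIS //; apply: bigcup_sup.
    rewrite cardsD bT.1; apply: leq_trans (leq_sub2l _ zj).
    apply: leq_trans (leq_mul (leqnn _) tm) _; rewrite mulnBr leq_sub2l //.
    exact: leq_pmull.
  by exists B; rewrite BT cB eqxx.
pose P : tile V k := [ffun j => xchoose (ex j)].
have PE j : P j \subset T j :\: Z /\ #|P j| = a j * (t * m).
  by rewrite ffunE; have /andP[-> /eqP] := xchooseP (ex j).
have bP : bottle e a (t * m) P.
  split=> [j|i j nij x y]; first exact: (PE j).2.
  move=> /(subsetP (PE i).1) /setDP[xT xZ] /(subsetP (PE j).1) /setDP[yT yZ].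
  by apply: e'e => //; apply: (bT.2 i j).
have [s bs cs] := split_bottle e_irr bP; exists s; split=> // [v|].
  rewrite cs (cov1E _ e_irr bP) (cov1E _ e'_irr bT).
  case: (boolP (v \in \bigcup_j P j)) => // /bigcupP[j _ /(subsetP (PE j).1)/setDP[vT _]].
  by rewrite (_ : v \in _) //; apply/bigcupP; exists j.
rewrite (eq_bigr _ (fun v _ => cs v)) (sum_cov (bottles1 bP)) (sum_cov (bottles1 bT)).
by rewrite !mul1n -mulnDr leq_mul2l tm' orbT.
Qed.

Lemma trim_bottles m Q (s : seq (tile V k)) : 0 < m -> bottles e' a (Q * m) s ->
  exists s', [/\ bottles e a m s', forall v, cov s' v <= cov s v
    & \sum_v cov s v <=
        \sum_v cov s' v + (\sum_j a j) * (\sum_(v in Z) cov s v + size s * m)].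
Proof.
move=> m_gt0; elim: s => [|T s IH] bs.
  by exists [::]; split=> //; rewrite [\sum_v _]big1 // => v _; rewrite cov_nil.
have [|s1 [b1 c1 d1]] := IH; first by apply: sub_bottles bs => T'; rewrite inE orbC => ->.
have bT := bs T (mem_head _ _).
have [s2 [b2 c2 d2]] := trim_bottle m_gt0 bT.
exists (s2 ++ s1); split; first exact: bottles_cat.
  by move=> v; rewrite cov_cat cov_cons leq_add.
have cc (A : {pred V}) : \sum_(v in A) cov (T :: s) v =
    \sum_(v in A) cov [:: T] v + \sum_(v in A) cov s v.
  by rewrite -big_split; apply: eq_bigr => v _; rewrite cov_cons.
have ccT : \sum_v cov (T :: s) v = \sum_v cov [:: T] v + \sum_v cov s v.
  by rewrite -big_split; apply: eq_bigr => v _; rewrite cov_cons.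
have cc2 : \sum_v cov (s2 ++ s1) v = \sum_v cov s2 v + \sum_v cov s1 v.
  by rewrite -big_split; apply: eq_bigr => v _; rewrite cov_cat.
rewrite ccT cc2 (cc (mem Z)).
have -> : \sum_(v in Z) cov [:: T] v = #|Z :&: \bigcup_j T j|.
  by rewrite (sum_cov_in _ e'_irr (bottles1 bT)) big_seq1.
apply: leq_trans (leq_add d2 d1) _.
by rewrite addnACA leq_add2l -mulnDr leq_mul2l /= mulSn addnACA leqnn orbT.
Qed.

End Trim.

Section Saturate.
Variables (V : finType) (e : rel V) (I : V -> nat).

(* Vertices of rank at least [t] are made adjacent to all others. *)
Definition saturate (t : nat) : rel V :=
  [rel x y | e x y || (x != y) && ((t <= I x) || (t <= I y))].

Lemma saturate_sym t : symmetric e -> symmetric (saturate t).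
Proof. by move=> es x y; rewrite /saturate /= es eq_sym [(t <= I x) || _]orbC. Qed.

Lemma saturate_irr t : irreflexive e -> irreflexive (saturate t).
Proof. by move=> ei x; rewrite /saturate /= ei eqxx. Qed.

Lemma saturate_top t : (forall v, I v < t) -> saturate t =2 e.
Proof. by move=> It x y; rewrite /saturate /= [t <= I x]leqNgt [t <= I y]leqNgt !It andbF orbF. Qed.

(** Raising the threshold from [t] to [t + d] removes only edges that meet the ranks from [t] to
    [t + d - 1]; these vertices form the set to be trimmed. *)
Lemma saturate_step t d x y :
  x \notin [set v | t <= I v < t + d] -> y \notin [set v | t <= I v < t + d] ->
  saturate t x y -> saturate (t + d) x y.
Proof.
rewrite !inE /saturate /= => xZ yZ /orP[->//|/andP[-> /orP[tx|ty]]].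
  by rewrite tx -leqNgt in xZ; rewrite xZ orbT.
by rewrite ty -leqNgt in yZ; rewrite yZ !orbT.
Qed.

End Saturate.

Definition admissible (R : realFieldType) k s0 w0 (eta : R) (V : finType) (e : rel V)
    (I : V -> nat) : Prop :=
  [/\ symmetric e, irreflexive e, injective I, forall v, (I v < #|V|)%N
    & degree_cond k s0 w0 e I eta].

Lemma admissible_saturate (R : realFieldType) k s0 w0 (eta : R) (V : finType) (e : rel V)
    (I : V -> nat) t :
  admissible k s0 w0 eta e I -> admissible k s0 w0 eta (saturate e I t) I.
Proof.
case=> es ei Ii Il deg; split=> //; [exact: saturate_sym|exact: saturate_irr|].
move=> x; have [d1 d2] := deg x.
have le_nbr : #|nbr e x| <= #|nbr (saturate e I t) x|.
  by apply/subset_leq_card/subsetP => y; rewrite !inE /saturate /= => ->.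
split=> [/d1|/d2] le; apply: le_trans le _; rewrite ler_nat leq_mul2l le_nbr orbT //.
Qed.

(** The starting point, at saturation threshold [0]. All parts are drawn from one pool. *)
Lemma complete_tiling (V : finType) (k m : nat) (e : rel V) (a : 'I_k.+1 -> nat) :
  (forall x y, x != y -> e x y) -> 0 < (\sum_j a j) * m ->
  exists2 s : seq (tile V k), tiling e a m s & #|uncovered s| < (\sum_j a j) * m.
Proof.
move=> ec hm; pose t := #|V| %/ ((\sum_j a j) * m).
have dem (i : unit) : \sum_(l < t) \sum_(j < k.+1 | tt == i) a j * m = t * ((\sum_j a j) * m).
  by case: i; rewrite sum_nat_const card_ord big_distrl.
have [||i|s [bs cs ds]] := @allocate_bottles V k e a 'I_t unit (fun=> setT) (fun _ _ => tt) m.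
- by case=> [] [].
- by move=> _ i j _ x y nxy _ _; apply: ec.
- by rewrite dem cardsT leq_trunc_div.
have ts : tiling e a m s by split=> // v; apply: leq_trans (cs v) (leq_b1 _).
exists s => //; have := card_uncovered ts; have := ds tt; rewrite dem.
rewrite (eq_bigl xpredT) => [|v]; last by rewrite inE.
rewrite (sum_cov bs) => -> /(canRL (addnK _)) ->.
have := ltn_ceil #|V| hm; rewrite -/t mulSn.
by move: (t * _) hm => q; clear; lia.
Qed.

(** * Copies of [H] in a bottle *)

Lemma bigminn_le (I : eqType) (r : seq I) (P : pred I) (F : I -> nat) x i :
  i \in r -> P i -> \big[minn/x]_(j <- r | P j) F j <= F i.
Proof.
elim: r => // j r IH; rewrite inE big_cons => /orP[/eqP<- Pi|ir Pi].
  by rewrite Pi geq_minl.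
by case: ifP => _; [apply: leq_trans (geq_minr _ _) _|]; apply: IH.
Qed.

Lemma bigminn_attained (I : eqType) (r : seq I) (P : pred I) (F : I -> nat) x :
  \big[minn/x]_(j <- r | P j) F j = x \/
  exists2 i, P i & \big[minn/x]_(j <- r | P j) F j = F i.
Proof.
elim: r => [|j r IH]; first by left; rewrite big_nil.
rewrite big_cons; case: ifP => // Pj; rewrite /minn; case: ifP => // _.
by right; exists j.
Qed.

Lemma sigma_le (H : sgraph) (f : {ffun H -> 'I_(chromatic_number H)}) c :
  proper_coloring f -> sigma H <= #|color_class f c|.
Proof.
move=> pf; apply: leq_trans (bigminn_le _ _ (mem_index_enum f) pf) _.
exact: (bigminn_le _ _ (mem_index_enum c) isT).
Qed.

Lemma chromatic_coloring (H : sgraph) :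
  exists f : {ffun H -> 'I_(chromatic_number H)}, proper_coloring f.
Proof. by apply/existsP; rewrite /chromatic_number; case: ex_minnP. Qed.

Lemma chromatic_min (H : sgraph) k : colorable H k -> chromatic_number H <= k.
Proof. by rewrite /chromatic_number; case: ex_minnP => m _; apply. Qed.

Lemma sigma_attained (H : sgraph) : 0 < chromatic_number H ->
  exists (f : {ffun H -> 'I_(chromatic_number H)}) c,
    proper_coloring f /\ #|color_class f c| = sigma H.
Proof.
(* If the minimum is the default value [#|vertex H|], every class attains it, since no class is
   larger. *)
move=> r_gt0; have all_classes (f : {ffun H -> 'I_(chromatic_number H)}) c :
    proper_coloring f -> sigma H = #|vertex H| -> #|color_class f c| = sigma H.
  by move=> pf sH; apply/eqP; rewrite eqn_leq sigma_le // sH max_card.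
have [g pg] := chromatic_coloring H.
have [sH|[f pf sf]] := bigminn_attained (index_enum _) (@proper_coloring H _)
  (fun f => \big[minn/#|vertex H|]_(c < chromatic_number H) #|color_class f c|) #|vertex H|.
  by exists g, (Ordinal r_gt0); split=> //; apply: all_classes.
have [sH|[c _ sc]] := bigminn_attained (index_enum _) xpredT
  (fun c => #|color_class f c|) #|vertex H|.
  exists f, (Ordinal r_gt0); split=> //; apply: all_classes => //.
  by rewrite -sH -sf.
by exists f, c; split=> //; rewrite -sc -sf.
Qed.

(** Removing the colour of an empty class would colour [H] with one colour fewer. *)
Lemma class_gt0 (H : sgraph) k (f : {ffun H -> 'I_k.+1}) c :
  chromatic_number H = k.+1 -> proper_coloring f -> 0 < #|color_class f c|.
Proof.
move=> rH pf; rewrite lt0n; apply/negP => /eqP/cards0_eq fc.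
suff : colorable H k by move=> /chromatic_min; rewrite rH ltnn.
have ul x : exists j, f x == lift c j.
  have [j ->|fx] := unliftP c (f x); first by exists j.
  have : x \in color_class f c by rewrite inE fx.
  by rewrite fc inE.
apply/existsP; exists [ffun x => xchoose (ul x)].
apply/forallP => x; apply/forallP => y; apply/implyP => xy; rewrite !ffunE.
move/forallP/(_ x)/forallP/(_ y)/implyP/(_ xy): pf; apply: contraNneq => exy.
by rewrite (eqP (xchooseP (ul x))) (eqP (xchooseP (ul y))) exy.
Qed.

Lemma edge_chromatic (H : sgraph) (x y : H) : adj x y -> 1 < chromatic_number H.
Proof.
move=> xy; have [f /forallP/(_ x)/forallP/(_ y)/implyP/(_ xy)] := chromatic_coloring H.
move: (f x) (f y); case: (chromatic_number H) => [[]//|[|//]] a b.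
by rewrite !ord1.
Qed.

Section Copies.
Variables (H G : sgraph) (k : nat) (f : {ffun H -> 'I_k.+2}) (c0 : 'I_k.+2).
Hypothesis pf : proper_coloring f.

(* The copies [l < k.+1] rotate the colours other than [c0] cyclically through the
   wide parts, so that together they fill all wide parts equally. *)
Let role (l : 'I_k.+1) (c : 'I_k.+2) : 'I_k.+2 :=
  if unlift c0 c is Some j then lift ord0 (j + l)%R else ord0.

Lemma role_inj l : injective (role l).
Proof.
move=> c c'; rewrite /role.
case: unliftP => [j ->|->]; case: unliftP => [j' ->|->] //.
by move=> /lift_inj/addIr->.
Qed.

Let sg := #|color_class f c0|.
Let a : 'I_k.+2 -> nat := part_size (k.+1 * sg) (#|vertex H| - sg).

(** A vertex of colour [c0] goes to the neck in all [k.+1] copies; any other vertex visits each wide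
    part in exactly one copy. *)
Lemma role_count i :
  #|[set u : 'I_k.+1 * H | role u.1 (f u.2) == i]| <= a i.
Proof.
have -> : #|[set u : 'I_k.+1 * H | role u.1 (f u.2) == i]| =
    \sum_(x : H) #|[set l | role l (f x) == i]|.
  rewrite -sum1_card; under [RHS]eq_bigr do rewrite -sum1_card.
  rewrite (exchange_big_dep xpredT) //= pair_big_dep /=.
  by apply: eq_bigl => u; rewrite !inE.
have [j ->|->] := unliftP ord0 i; last first.
  have -> : a ord0 = \sum_(x in color_class f c0) k.+1.
    by rewrite /a /part_size eqxx sum_nat_const mulnC.
  rewrite [leqRHS]big_mkcond; apply: leq_sum => x _; rewrite inE.
  case: eqVneq => [_|nc]; first by rewrite -[leqRHS]card_ord max_card.
  rewrite leqn0 cards_eq0; apply/eqP/setP => l; rewrite !inE /role.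
  by case: unliftP nc => [j ->|->]; rewrite ?eqxx // eq_sym (negbTE (neq_lift _ _)).
have -> : a (lift ord0 j) = \sum_(x in ~: color_class f c0) 1.
  by rewrite /a /part_size eq_sym (negbTE (neq_lift _ _)) sum1_card cardsCs setCK.
rewrite [leqRHS]big_mkcond; apply: leq_sum => x _; rewrite !inE /role.
case: unliftP => [j' ->|->] /=.
  rewrite eq_sym neq_lift -(cards1 (j - j')%R); apply/subset_leq_card/subsetP => l.
  by rewrite !inE (inj_eq lift_inj) => /eqP<-; rewrite addrC addKr.
rewrite eqxx leqn0 cards_eq0; apply/eqP/setP => l; rewrite !inE.
exact/negbTE/neq_lift.
Qed.

(** By [role_count] the copies fit disjointly into the bottle, and their total size
    [k.+1 * #|vertex H|] is its height, so they cover it. *)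
Lemma bottle_copies (T : tile G k.+1) : bottle (@adj G) a 1 T ->
  exists F : {set {ffun H -> G}}, is_tiling F /\ covered F = \bigcup_j T j.
Proof.
move=> bT; have eI := @adj_irr G.
have [|i|g g_inj gT] := @allocation G ('I_k.+1 * H)%type 'I_k.+2 T
  (fun u => role u.1 (f u.2)).
- by move=> i j; apply: bottle_disjoint eI bT.
- by rewrite bT.1 muln1 role_count.
pose F l : {ffun H -> G} := [ffun x => g (l, x)].
have F_inj l : injective (F l) by move=> x y; rewrite !ffunE => /g_inj[].
have disF l l' : F l != F l' -> [disjoint copy_vertices (F l) & copy_vertices (F l')].
  move=> nF; rewrite -setI_eq0; apply/eqP/setP => v; rewrite !inE; apply/negP.
  case/andP=> /imsetP[x _ ->] /imsetP[y _]; rewrite !ffunE => /g_inj[ell _].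
  by rewrite ell eqxx in nF.
exists [set F l | l : 'I_k.+1]; split; first split.
- move=> _ /imsetP[l _ ->]; apply/andP; split; first exact/injectiveP/F_inj.
  apply/forallP => x; apply/forallP => y; apply/implyP => xy; rewrite !ffunE.
  apply: (bT.2 (role l (f x)) (role l (f y))); try exact: (gT (l, _)).
  by rewrite (inj_eq (@role_inj l)); move/forallP/(_ x)/forallP/(_ y)/implyP/(_ xy): pf.
- by move=> _ _ /imsetP[l _ ->] /imsetP[l' _ ->]; apply: disF.
have covE : covered [set F l | l : 'I_k.+1] = [set g u | u : 'I_k.+1 * H].
  apply/setP => v; apply/bigcupP/imsetP.
    by case=> _ /imsetP[l _ ->] /imsetP[x _ ->]; exists (l, x); rewrite ?ffunE.
  case=> -[l x] _ ->; exists (F l); first exact: imset_f.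
  by apply/imsetP; exists x; rewrite ?ffunE.
apply/eqP; rewrite eqEcard covE (card_bottle eI bT) card_imset //; apply/andP; split.
  by apply/subsetP => _ /imsetP[u _ ->]; apply/bigcupP; exists (role u.1 (f u.2)).
have sgH : sg <= #|vertex H| by apply: max_card.
rewrite muln1 sum_part_size /height card_prod card_ord -mulnDr leq_mul2l /=.
by rewrite addnC subnKC.
Qed.

Lemma bottles_copies (s : seq (tile G k.+1)) : tiling (@adj G) a 1 s ->
  exists F : {set {ffun H -> G}}, is_tiling F /\ covered F = ~: uncovered s.
Proof.
case; have eI := @adj_irr G; elim: s => [|T s IH] bs cs.
  exists set0; split; first by split=> ? ; rewrite inE.
  by apply/setP => v; rewrite /covered big_set0 !inE cov_nil.
have bT := bs T (mem_head _ _).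
have [||F [[F1 F2] cF]] := IH.
- by apply: sub_bottles bs => T'; rewrite inE orbC => ->.
- by move=> v; apply: leq_trans (cs v); rewrite cov_cons leq_addl.
have [F' [[F1' F2'] cF']] := bottle_copies bT.
have dis g g' : g \in F' -> g' \in F -> [disjoint copy_vertices g & copy_vertices g'].
  move=> gF gF'; rewrite -setI_eq0; apply/eqP/setP => v; rewrite in_setI in_set0; apply/negP.
  case/andP => vg vg'.
  have vT : v \in \bigcup_j T j by rewrite -cF'; apply/bigcupP; exists g.
  have : v \in ~: uncovered s by rewrite -cF; apply/bigcupP; exists g'.
  by have := cs v; rewrite cov_cons (cov1E _ eI bT) vT !inE; case: (cov s v).
exists (F' :|: F); split; first split.
- by move=> g; rewrite inE => /orP[/F1'|/F1].
- move=> g g'; rewrite !inE => /orP[gF|gF] /orP[gF'|gF'] ng.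
  + exact: F2'.
  + exact: dis.
  + by rewrite disjoint_sym; apply: dis.
  + exact: F2.
rewrite /covered bigcup_setU -!/(covered _) cF' cF; apply/setP => v.
by rewrite inE !in_setC !inE cov_cons (cov1E _ eI bT); case: (v \in _).
Qed.

End Copies.

(** * Choice of the constants and the main iteration *)

Local Open Scope ring_scope.

Lemma truncn_bounds (R : archiRealFieldType) (x : R) :
  0 <= x -> x - 1 <= (Num.truncn x)%:R <= x.
Proof. by move=> /truncn_itv; rewrite -natr1; lra. Qed.

(* Slope of the weight, times the rank difference [Z / n], times [p q / n], where [q] bottles
   are improved, each in a sub-bottle of level [p]. *)
Definition round_gain (R : realFieldType) (k s0 w0 K : nat) (eta : R) : R :=
  (2 * w0%:R)^-1 * (eta / 16) * (eta / (16 * (height k s0 w0)%:R * K.+1%:R)).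

(** The factor by which one round lowers the level; it does not depend on [m]. *)
Definition level_ratio (k s0 w0 K : nat) : nat :=
  (K.+1 * (k * (height k s0 w0 - w0)))%N.

Lemma improve_round (R : archiRealFieldType) (k s0 w0 K : nat) (eta : R)
    (V : finType) (e : rel V) (I : V -> nat) (eps : R) m (s : seq (tile V k)) :
  let h := height k s0 w0 in let a := part_size s0 w0 in
  let C := level_ratio k s0 w0 K in
  (0 < k)%N -> (0 < s0)%N -> (s0 <= w0)%N -> 0 < eta -> eta <= 1 ->
  (k.+1 * w0 + s0)%:R <= eta / 8 * (h * K.+1)%:R ->
  symmetric e -> irreflexive e -> injective I -> (forall v, I v < #|V|)%N ->
  degree_cond k s0 w0 e I eta -> (0 < m)%N ->
  16 <= eta * #|V|%:R -> 16 * (h * (C * m))%:R <= eta * #|V|%:R ->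
  (4 ^ (h * (C * m)) * (h * h * (C * m)))%N%:R <= eta / 2 * (eps * #|V|%:R) ->
  tiling e a (C * m) s -> #|uncovered s|%:R <= eta / 8 * #|V|%:R ->
  exists2 s', tiling e a m s' &
    #|uncovered s'|%:R <= eps * #|V|%:R \/
    covered_weight (weight R w0 I) s + round_gain k s0 w0 K eta * #|V|%:R
      <= covered_weight (weight R w0 I) s'.
Proof.
move=> h a C k_gt0 s0_gt0 s0_le_w0 eta_gt0 eta_le1 K_big e_sym e_irr I_inj I_lt deg m_gt0.
move=> n1 n2 n3 ts us.
set n := #|V| in n1 n2 n3 us *; set p := (k * (h - w0) * m)%N.
have pM : (C * m = K.+1 * p)%N by rewrite /C /level_ratio /p -mulnA.
have n_gt0 : 0 < n%:R :> R by rewrite -(pmulr_rgt0 _ eta_gt0); move: n1; lra.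
have h_gt0 : (0 < h)%N by rewrite /h /height addn_gt0 s0_gt0 orbT.
have hM_gt0 : 0 < (h * (C * m))%:R :> R.
  rewrite ltr0n !muln_gt0 h_gt0 k_gt0 m_gt0 /= /h height_split // addnK.
  by rewrite addn_gt0 s0_gt0 orbT.
(* The truncations of [x] and [y] give the rank shift [Z] and the number [q] of tiles to use up;
   these tiles contain about [x] vertices. *)
have [x xE] : exists x, x = eta / 8 * n%:R by exists (eta / 8 * n%:R).
have [y yE] : exists y, y = x / (h * (C * m))%:R by exists (x / (h * (C * m))%:R).
have x0 : 0 <= x by rewrite xE mulr_ge0 ?ler0n // divr_ge0 ?ler0n ?ltW.
have y0 : 0 <= y by rewrite yE divr_ge0 // ltW.
have /andP[Z1 Z2] := truncn_bounds x0; have /andP[q1 q2] := truncn_bounds y0.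
move: (Num.truncn x) (Num.truncn y) Z1 Z2 q1 q2 => Z q Z1 Z2 q1 q2.
have ZN : (Z <= n)%N.
  rewrite -(ler_nat R); apply: le_trans Z2 _; rewrite xE ler_piMl ?ler0n //. lra.
have qx : (q * (h * (C * m)))%:R <= x by rewrite (natrM _ q) -ler_pdivlMr // -yE.
have qx' : x - (h * (C * m))%:R <= (q * (h * (C * m)))%:R.
  rewrite (natrM _ q); have := ler_wpM2r (ltW hM_gt0) q1.
  by rewrite mulrBl mul1r yE divfK ?gt_eqF.
rewrite pM in ts n3 qx qx' *.
have {}Z2 : Z%:R <= eta / 8 * #|V|%:R by move: Z2; rewrite xE.
have [||s' ts' Ps'] := @improve_many R V k s0 w0 e I eta e_sym e_irr k_gt0 s0_gt0
  s0_le_w0 I_inj I_lt eta_gt0 deg m K Z m_gt0 K_big Z2 eps s q ZN ts.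
- rewrite -/h -/p -/n; move: qx us; rewrite xE; lra.
- rewrite -/h -/p -/n; apply: le_trans n3; rewrite ler_nat leq_mul2l; apply/orP; right.
  by rewrite leq_mul2l leq_pmull ?orbT.
exists s' => //; case: Ps' => [?|Ps']; [by left|right].
apply: le_trans Ps'; rewrite lerD2l -/h -/p -/n.
(* Truncation costs at most [1], which is at most half of [x] since [eta * n >= 16]. *)
have Zn : eta / 16 <= Z%:R / n%:R.
  by rewrite ler_pdivlMr //; move: Z1 n1; rewrite xE; lra.
have hK : 0 < 16 * h%:R * K.+1%:R :> R by rewrite !mulr_gt0 ?ltr0n.
have pq : eta / (16 * h%:R * K.+1%:R) * n%:R <= p%:R * q%:R.
  rewrite mulrAC ler_pdivrMr //.
  by move: qx' n2; rewrite pM xE !natrM; lra.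
have main : eta / 16 * (eta / (16 * h%:R * K.+1%:R) * n%:R) <= Z%:R / n%:R * (p%:R * q%:R).
  apply: ler_pM => //; first by rewrite divr_ge0 ?ler0n ?ltW.
  by rewrite !mulr_ge0 ?ler0n ?invr_ge0 ?ltW.
have w2 : 0 <= (2 * w0%:R)^-1 :> R by rewrite invr_ge0 mulr_ge0 ?ler0n.
by have := ler_wpM2l w2 main; rewrite /round_gain -!mulrA.
Qed.

Lemma eventually_ge (R : archiRealFieldType) (c A : R) : 0 < c ->
  exists n0, forall n, (n0 <= n)%N -> A <= c * n%:R.
Proof.
move=> c0; exists (Num.bound (Num.max A 0 / c)) => n le_n.
have A0 : 0 <= Num.max A 0 by rewrite le_max lexx orbT.
apply: le_trans (_ : Num.max A 0 <= _); first by rewrite le_max lexx.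
rewrite mulrC -ler_pdivrMr //; apply: le_trans (ltW (archi_boundP _)) _.
  by rewrite divr_ge0 // ltW.
by rewrite ler_nat.
Qed.

(** Each round divides the level by [C]. The induction on [j] peels off the last round, which leads
    from [C * m] to [m]; if the earlier rounds already left few vertices uncovered, the bottles are
    merely split. *)
Lemma improve_rounds (R : archiRealFieldType) (k s0 w0 K : nat) (eta eps : R) (j m : nat) :
  let h := height k s0 w0 in let a : 'I_k.+1 -> nat := part_size s0 w0 in
  let C := level_ratio k s0 w0 K in
  (0 < k)%N -> (0 < s0)%N -> (s0 <= w0)%N -> 0 < eta -> eta <= 1 ->
  (k.+1 * w0 + s0)%:R <= eta / 8 * (h * K.+1)%:R ->
  (0 < m)%N -> 0 < eps ->
  exists n0, forall (V : finType) (e : rel V) (I : V -> nat) (s : seq (tile V k)),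
    admissible k s0 w0 eta e I -> (n0 <= #|V|)%N ->
    tiling e a (C ^ j * m) s -> #|uncovered s|%:R <= eta / 16 * #|V|%:R ->
    exists2 s', tiling e a m s' &
      #|uncovered s'|%:R <= eps * #|V|%:R \/
      covered_weight (weight R w0 I) s + j%:R * round_gain k s0 w0 K eta * #|V|%:R
        <= covered_weight (weight R w0 I) s'.
Proof.
move=> h a C k_gt0 s0_gt0 s0_le_w0 eta_gt0 eta_le1 K_big m_gt0 eps_gt0.
elim: j m m_gt0 => [|j IH] m m_gt0.
  exists 0%N => V e I s _ _; rewrite expn0 mul1n => ts us.
  by exists s => //; right; rewrite !mul0r addr0.
have C_gt0 : (0 < C)%N.
  rewrite /C /level_ratio !muln_gt0 k_gt0 /= height_split // addnK.
  by rewrite addn_gt0 s0_gt0 orbT.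
have [|n1 Hn1] := IH (C * m)%N; first by rewrite muln_gt0 C_gt0.
have [n2 Hn2] := eventually_ge 16 eta_gt0.
have [n3 Hn3] := eventually_ge (16 * (h * (C * m))%:R) eta_gt0.
have [n4 Hn4] := eventually_ge (4 ^ (h * (C * m)) * (h * h * (C * m)))%N%:R
  (mulr_gt0 (divr_gt0 eta_gt0 (ltr0n R 2)) eps_gt0).
exists (maxn (maxn n1 n2) (maxn n3 n4)) => V e I s adm.
rewrite !geq_max => /andP[/andP[le1 le2] /andP[le3 le4]]; rewrite expnSr -mulnA => ts us.
have [e_sym e_irr I_inj I_lt deg] := adm.
have [s1 t1 []] := Hn1 V e I s adm le1 ts us => [u1|P1].
  have [s' b' c'] := split_bottles e_irr t1.1.
  exists s'; first by split=> // v; rewrite c'; apply: t1.2.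
  by left; rewrite (eq_uncovered c').
have gain0 : 0 <= j%:R * round_gain k s0 w0 K eta * #|V|%:R.
  rewrite !mulr_ge0 ?ler0n // ?invr_ge0 ?mulr_ge0 ?ler0n //; exact: ltW.
have d1 := deficit_ge R s0_gt0 s0_le_w0 I_lt t1.2.
have d2 := deficit_le R w0 I ts.2.
(* The potential has not decreased, so the deficit is still at most [eta / 16 * #|V|]; the number of
   uncovered vertices is at most twice that. *)
have us1 : #|uncovered s1|%:R <= eta / 8 * #|V|%:R by move: d1 d2 P1 us gain0; lra.
have := Hn4 _ le4; rewrite -[leRHS]mulrA => f4.
have [s' ts' us'] := improve_round k_gt0 s0_gt0 s0_le_w0 eta_gt0 eta_le1 K_big
  e_sym e_irr I_inj I_lt deg m_gt0 (Hn2 _ le2) (Hn3 _ le3) f4 t1 us1.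
exists s' => //; case: us' => [?|Ps']; [by left|right].
apply: le_trans Ps'; rewrite -natr1 !mulrDl mul1r addrA lerD2r //.
Qed.

Lemma absorption (R : archiRealFieldType) (k s0 w0 : nat) (eta eps : R) (m : nat) :
  let a : 'I_k.+1 -> nat := part_size s0 w0 in
  (0 < k)%N -> (0 < s0)%N -> (s0 <= w0)%N -> 0 < eta -> eta <= 1 ->
  (0 < m)%N -> 0 < eps ->
  exists m0 n0, (0 < m0)%N /\
    forall (V : finType) (e : rel V) (I : V -> nat) (s : seq (tile V k)),
    admissible k s0 w0 eta e I -> (n0 <= #|V|)%N ->
    tiling e a m0 s -> #|uncovered s|%:R <= eta / 16 * #|V|%:R ->
    exists2 s', tiling e a m s' & #|uncovered s'|%:R <= eps * #|V|%:R.
Proof.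
move=> a k_gt0 s0_gt0 s0_le_w0 eta_gt0 eta_le1 m_gt0 eps_gt0.
pose h := height k s0 w0.
have h_gt0 : (0 < h)%N by rewrite /h /height addn_gt0 s0_gt0 orbT.
have w0_gt0 : (0 < w0)%N by apply: leq_trans s0_le_w0.
have eh : 0 < eta / 8 * h%:R by rewrite mulr_gt0 ?ltr0n // divr_gt0.
(* With [K] large, the thresholds [w0 * p] are a small proportion of a tile of level [K.+1 * p]. *)
have [K /(_ _ (leqnSn K))] := eventually_ge (k.+1 * w0 + s0)%:R eh.
rewrite -mulrA -natrM => K_big.
have g_gt0 : 0 < round_gain k s0 w0 K eta.
  by rewrite /round_gain !(mulr_gt0, divr_gt0, invr_gt0, ltr0n).
(* After [j] rounds the potential would exceed the total weight: the initial deficit is at most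
   [eta / 16 * #|V|], and the extra [#|V|] makes the contradiction strict. *)
have [j /(_ _ (leqnn j)) Hj] := eventually_ge (eta / 16 + 1) g_gt0.
have [n0 Hn0] := improve_rounds j k_gt0 s0_gt0 s0_le_w0 eta_gt0 eta_le1 K_big m_gt0 eps_gt0.
have C_gt0 : (0 < level_ratio k s0 w0 K)%N.
  rewrite /level_ratio !muln_gt0 k_gt0 /= height_split // addnK.
  by rewrite addn_gt0 s0_gt0 orbT.
exists (level_ratio k s0 w0 K ^ j * m)%N, (maxn n0 1); split.
  by rewrite muln_gt0 expn_gt0 C_gt0.
move=> V e I s adm; rewrite geq_max => /andP[le0 V_gt0] ts us.
have [s' ts' [us'|Ps']] := Hn0 V e I s adm le0 ts us; exists s' => //.
have [_ _ _ I_lt _] := adm.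
have d1 := deficit_ge R s0_gt0 s0_le_w0 I_lt ts'.2.
have d2 := deficit_le R w0 I ts.2.
have V1 : 0 < #|V|%:R :> R by rewrite ltr0n.
have u0 : 0 <= #|uncovered s'|%:R :> R by rewrite ler0n.
have := ler_wpM2r (ltW V1) Hj; rewrite mulrDl mul1r [_ * j%:R]mulrC.
move: d1 d2 us Ps' V1 u0; lra.
Qed.

(** Induction on the number [j] of steps, each giving up the surplus edges of [d] more ranks: the
    previous tiling is trimmed and then repaired by [absorption]. As the repair needs bottles of a
    higher level to start from, [m] and [eps] vary in the induction. *)
Lemma saturated_tiling (R : archiRealFieldType) (k s0 w0 : nat) (eta delta : R) (j : nat) :
  let a : 'I_k.+1 -> nat := part_size s0 w0 in
  (0 < k)%N -> (0 < s0)%N -> (s0 <= w0)%N -> 0 < eta -> eta <= 1 ->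
  0 < delta -> (height k s0 w0)%:R * delta <= eta / 64 ->
  forall (m : nat) (eps : R), (0 < m)%N -> 0 < eps ->
  exists n0, forall (V : finType) (e : rel V) (I : V -> nat) (d : nat),
    admissible k s0 w0 eta e I -> (n0 <= #|V|)%N -> d%:R <= delta * #|V|%:R ->
    exists2 s : seq (tile V k), tiling (saturate e I (j * d)) a m s &
      #|uncovered s|%:R <= eps * #|V|%:R.
Proof.
move=> a k_gt0 s0_gt0 s0_le_w0 eta_gt0 eta_le1 delta_gt0 hdelta.
set h := height k s0 w0 in hdelta *.
have aE : (\sum_i a i)%N = h by apply: sum_part_size.
have h_gt0 : (0 < h)%N by rewrite /h /height addn_gt0 s0_gt0 orbT.
elim: j => [|j IH] m eps m_gt0 eps_gt0.
  have [n0 Hn0] := eventually_ge (h * m)%:R eps_gt0.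
  exists n0 => V e I d adm le0 _.
  have [x y nxy||s ts us] := @complete_tiling V k m (saturate e I (0 * d)) a.
  - by rewrite /saturate /= nxy ?mul0n ?orbT.
  - by rewrite aE muln_gt0 h_gt0.
  exists s => //; apply: le_trans (Hn0 _ le0).
  by rewrite ler_nat ltnW // -aE.
have [m0 [n1 [m0_gt0 Hn1]]] :=
  absorption k_gt0 s0_gt0 s0_le_w0 eta_gt0 eta_le1 m_gt0 eps_gt0.
have eta64 : 0 < eta / 64 by rewrite divr_gt0.
(* Rounding to level [m0] loses at most a proportion [1 / Q.+1] of the vertices. The old leftover,
   the trimmed ranks and the rounding then cost at most [eta / 64 * #|V|] each, within the
   [eta / 16 * #|V|] that [absorption] allows. *)
have [Q /(_ _ (leqnSn Q)) HQ] := eventually_ge 1 eta64.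
have Qm0 : (0 < Q.+1 * m0)%N by rewrite muln_gt0.
have [n2 Hn2] := IH (Q.+1 * m0)%N (eta / 64) Qm0 eta64.
exists (maxn n1 n2) => V e I d adm; rewrite geq_max => /andP[le1 le2] dd.
have [s ts us] := Hn2 V e I d adm le2 dd.
have [_ e_irr I_inj _ _] := adm.
have jd : (j.+1 * d = j * d + d)%N by rewrite mulSn addnC.
have step x y : x \notin [set v | j * d <= I v < j * d + d]%N ->
    y \notin [set v | j * d <= I v < j * d + d]%N ->
    saturate e I (j * d) x y -> saturate e I (j.+1 * d) x y.
  by rewrite jd; apply: saturate_step.
set Z := [set v | _] in step.
have a_gt0 i : (0 < a i)%N by apply: leq_trans (part_size_ge s0_le_w0 i).
have [s1 [b1 c1 d1]] := trim_bottles (saturate_irr I _ e_irr) (saturate_irr I _ e_irr)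
  a_gt0 step m0_gt0 ts.1.
have t1 : tiling (saturate e I (j.+1 * d)) a m0 s1.
  by split=> // v; apply: leq_trans (c1 v) (ts.2 v).
apply: (Hn1 V _ I s1) => //; first exact: admissible_saturate.
have covZ : (\sum_(v in Z) cov s v <= d)%N.
  by apply: leq_trans (card_le_cov _ ts.2) _; apply: card_interval.
have U0 := card_uncovered ts; have U1 := card_uncovered t1.
rewrite -(sum_cov ts.1) in U0; rewrite -(sum_cov t1.1) in U1.
have size_le : (size s * (h * (Q.+1 * m0)) <= #|V|)%N.
  by rewrite -aE -(sum_cov ts.1) -U0 leq_addl.
have Ule : (#|uncovered s1| <= #|uncovered s| + h * d + h * (size s * m0))%N.
  have : (h * (\sum_(v in Z) cov s v + size s * m0) <= h * (d + size s * m0))%N.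
    by rewrite leq_mul2l leq_add2r covZ orbT.
  move: d1 U0 U1; rewrite aE -addnA -mulnDr.
  move: (h * (d + _))%N (h * (_ + _))%N (\sum_v cov s v)%N (\sum_v cov s1 v)%N.
  by clear; lia.
have lossm : (h * (size s * m0))%:R <= eta / 64 * #|V|%:R.
  have : (h * (size s * m0))%:R * Q.+1%:R <= #|V|%:R :> R.
    rewrite -natrM ler_nat (leq_trans _ size_le) //.
    by apply: eq_leq; move: (size s) (Q.+1) => S q; clear; ring.
  move=> /(ler_wpM2l (ltW eta64)); apply: le_trans.
  rewrite mulrCA ler_peMr ?ler0n //.
have lossd : (h * d)%:R <= eta / 64 * #|V|%:R.
  rewrite natrM; apply: le_trans (ler_wpM2l (ler0n _ h) dd) _.
  by rewrite mulrA ler_wpM2r ?ler0n.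
have := Ule; rewrite -(ler_nat R) !natrD.
have : 0 <= eta * #|V|%:R by rewrite mulr_ge0 ?ler0n ?ltW.
move: us lossm lossd; lra.
Qed.

Lemma almost_tiling (R : archiRealFieldType) (k s0 w0 : nat) (eta : R) (m : nat) (eps : R) :
  (0 < k)%N -> (0 < s0)%N -> (s0 <= w0)%N -> 0 < eta -> eta <= 1 ->
  (0 < m)%N -> 0 < eps ->
  exists n0, forall (V : finType) (e : rel V) (I : V -> nat),
    admissible k s0 w0 eta e I -> (n0 <= #|V|)%N ->
    exists2 s : seq (tile V k), tiling e (part_size s0 w0) m s &
      #|uncovered s|%:R <= eps * #|V|%:R.
Proof.
move=> k_gt0 s0_gt0 s0_le_w0 eta_gt0 eta_le1 m_gt0 eps_gt0.
set h := height k s0 w0.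
have h_gt0 : 0 < h%:R :> R by rewrite ltr0n /h /height addn_gt0 s0_gt0 orbT.
pose delta := eta / 64 / h%:R.
have delta_gt0 : 0 < delta by rewrite !divr_gt0.
have hdelta : h%:R * delta <= eta / 64 by rewrite mulrC divfK // gt_eqF.
(* Truncation at most halves [delta * #|V|], so with [j * delta >= 2] the threshold [j * d] lies
   above all ranks and the saturated graph is the given one. *)
have [j /(_ _ (leqnn j)) Hj] := eventually_ge 2 delta_gt0.
have [n0 Hn0] := saturated_tiling j k_gt0 s0_gt0 s0_le_w0 eta_gt0 eta_le1 delta_gt0
  hdelta m_gt0 eps_gt0.
have [n1 Hn1] := eventually_ge 2 delta_gt0.
exists (maxn n0 n1) => V e I adm; rewrite geq_max => /andP[le0 le1].
have V2 := Hn1 _ le1.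
have dV0 : 0 <= delta * #|V|%:R by rewrite mulr_ge0 ?ler0n ?ltW.
have /andP[d1 d2] := truncn_bounds dV0; set d := Num.truncn _ in d1 d2.
have [_ _ _ I_lt _] := adm.
have Vjd : (#|V| <= j * d)%N.
  have dd : delta * #|V|%:R / 2 <= d%:R by move: V2 d1; lra.
  rewrite -(ler_nat R) natrM.
  have := ler_wpM2l (ler0n R j) dd; apply: le_trans.
  have jd2 : 1 <= j%:R * delta / 2 by move: Hj; lra.
  by have := ler_wpM2r (ler0n R #|V|) jd2; lra.
have [s [bs cs] us] := Hn0 V e I d adm le0 d2.
exists s => //; split=> // T sT; have [cT eT] := bs T sT; split=> // i i' nii x y xT yT.
have := eT i i' nii x y xT yT; rewrite saturate_top // => v.
exact: leq_trans (I_lt v) Vjd.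
Qed.

(** * From the degree sequence to ranks *)

Lemma degree_rank (G : sgraph) : exists I : G -> nat,
  [/\ injective I, forall v, (I v < #|vertex G|)%N
    & forall v i, (i <= (I v).+1)%N -> (nth_degree G i <= degree v)%N].
Proof.
pose vs := sort (relpre (@degree G) leq) (enum (vertex G)).
have vsE : degree_seq G = map (@degree G) vs by rewrite /degree_seq sort_map.
have in_vs v : v \in vs by rewrite mem_sort mem_enum.
have lt_vs v : (index v vs < size vs)%N by rewrite index_mem.
(* Ranks start at [0] and the degree sequence at [1], so [v] has the degree numbered [(I v).+1]. *)
exists (fun v => index v vs); split=> [v v' eI|v|v i le_i].
- by rewrite -(nth_index v (in_vs v)) eI nth_index.
- by have := lt_vs v; rewrite size_sort -cardE.
have -> : degree v = nth 0%N (degree_seq G) (index v vs).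
  by rewrite vsE (nth_map v) // nth_index.
have srt : sorted leq (degree_seq G) by apply: sort_sorted leq_total _.
have le_i' : (i.-1 <= index v vs)%N by case: i le_i.
apply: (sorted_leq_nth leq_trans leqnn 0%N srt) => //; rewrite inE vsE size_map //.
exact: leq_ltn_trans (lt_vs v).
Qed.

(** Half of [eta] pays for rounding the cutoff to an integer: the required degree grows by at most
    [sg / omega <= 1] per index, and [1 <= eta / 2 * n]. *)
Lemma degree_seq_admissible (R : realFieldType) (G : sgraph) (k hh sg : nat) (eta : R) :
  let n := #|vertex G| in
  let omega : R := (hh%:R - sg%:R) / (k.+1%:R - 1) in
  (0 < k)%N -> (0 < sg)%N -> (k * sg <= hh - sg)%N -> 0 < eta ->
  (height k (k * sg) (hh - sg) <= n)%N -> 2 <= eta * n%:R ->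
  (forall i : nat, (1 <= i)%N -> i%:R <= omega * n%:R / hh%:R ->
     (1 - (omega + sg%:R) / hh%:R) * n%:R + sg%:R / omega * i%:R + eta * n%:R
       <= (nth_degree G i)%:R) ->
  exists I, admissible k (k * sg) (hh - sg) (eta / 2) (@adj G) I.
Proof.
move=> n omega k_gt0 sg_gt0 ksg eta_gt0 le_n eta_n deg.
have [I [I_inj I_lt I_deg]] := degree_rank G; exists I.
have W_gt0 : (0 < hh - sg)%N by apply: leq_trans ksg; rewrite muln_gt0 k_gt0.
have sg_hh : (sg <= hh)%N by rewrite ltnW // -subn_gt0.
set W := (hh - sg)%N in ksg le_n W_gt0 *; set h := height k (k * sg) W in le_n *.
have hE : h = (k * hh)%N by rewrite /h /height -mulnDr subnK.
have h_gt0 : (0 < h)%N by rewrite hE muln_gt0 k_gt0 (leq_trans sg_gt0).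
have hs := height_split (k * sg) W k_gt0; rewrite -/h in hs.
set B := (h - k * sg - W)%N in hs.
have key i x : (0 < i)%N -> (h * i <= W * n)%N -> (i <= (I x).+1)%N ->
    (W * B * n + k * sg * h * i)%:R + eta * (W * h * n)%:R <= (W * h * degree x)%:R.
  move=> i_gt0 hi iIx.
  have k0 : 0 < k%:R :> R by rewrite ltr0n.
  have W0 : 0 < W%:R :> R by rewrite ltr0n.
  have hh0 : 0 < hh%:R :> R by rewrite ltr0n (leq_trans sg_gt0).
  have omE : omega = W%:R / k%:R by rewrite /omega -natr1 addrK natrB.
  have /(deg i i_gt0) le_deg : i%:R <= omega * n%:R / hh%:R.
    rewrite omE ler_pdivlMr // mulrAC ler_pdivlMr // -!natrM ler_nat.
    by apply: leq_trans hi; rewrite hE; apply: eq_leq; clear; ring.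
  have le_deg' : (nth_degree G i)%:R <= (degree x)%:R :> R by rewrite ler_nat I_deg.
  have hR : h%:R = k%:R * hh%:R :> R by rewrite hE natrM.
  have BE : B%:R = k%:R * hh%:R - k%:R * sg%:R - W%:R :> R.
    have := congr1 (fun i => i%:R : R) hs; rewrite hR /= !natrD natrM; lra.
  have Wh0 : 0 < W%:R * h%:R :> R by rewrite mulr_gt0 ?ltr0n.
  have := le_trans le_deg le_deg'; rewrite -(ler_pM2l Wh0) !natrM !natrD !natrM.
  apply: le_trans; rewrite le_eqVlt; apply/orP; left; apply/eqP.
  have hhE : hh%:R = W%:R + sg%:R :> R by rewrite -natrD subnK.
  rewrite hhE in hh0 *; rewrite BE hR omE hhE; field.
  by rewrite !gt_eqF.
(* The largest index to which the hypothesis applies; it is at least [1] because [h <= n]. *)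
pose i0 := (W * n %/ h)%N.
have hi0 : (h * i0 <= W * n)%N by rewrite mulnC leq_trunc_div.
have hi0' : (W * n < h * i0.+1)%N by rewrite [ltnRHS]mulnC ltn_ceil.
have i0_gt0 : (0 < i0)%N by rewrite divn_gt0 // (leq_trans le_n) // leq_pmull.
have en : 0 <= eta * n%:R by lra.
split=> //; [exact: adj_sym|exact: adj_irr|move=> x; rewrite -/h -/B].
rewrite -[#|nbr _ x|]/(degree x); clearbody B h; split=> [hi|lo].
  have i0I : (i0 <= (I x).+1)%N.
    by rewrite ltnW // ltnS -(leq_pmul2l h_gt0) (leq_trans hi0).
  have k1 := key i0 x i0_gt0 hi0 i0I.
  have W1 : 0 < W%:R :> R by rewrite ltr0n.
  have hBW : (h - W = B + k * sg)%N by rewrite {1}hs addnK.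
  rewrite -(ler_pM2l W1) hBW.
  have k2 : (k * sg * (W * n))%:R <= (k * sg * (h * i0.+1))%:R :> R.
    by rewrite ler_nat leq_mul2l (ltnW hi0') orbT.
  have k3 : (k * sg * h)%:R <= (W * h)%:R :> R by rewrite ler_nat leq_mul2r ksg orbT.
  have Wh : 0 <= (W * h)%:R :> R by rewrite ler0n.
  have k4 := ler_wpM2l Wh eta_n.
  move: k1 k2 k3 k4; rewrite -[i0.+1]addn1 !mulnDr !natrD !natrM !mulrDr; lra.
have le_eta : eta / 2 * (W * h * n)%:R <= eta * (W * h * n)%:R.
  by rewrite ler_wpM2r ?ler0n //; lra.
have [le_i0|gt_i0] := leqP (I x).+1 i0.
  have hI : (h * (I x).+1 <= W * n)%N by apply: leq_trans hi0; rewrite leq_mul2l le_i0 orbT.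
  apply: le_trans (key (I x).+1 x isT hI (leqnn _)); apply: lerD le_eta.
  by rewrite ler_nat leq_add2l leq_mul2l leqnSn orbT.
(* Here [(I x).+1] is out of range, but the index [I x] itself is enough. *)
have iI : i0 = I x.
  apply/eqP; rewrite eqn_leq -ltnS gt_i0 /=.
  by rewrite -ltnS -(ltn_pmul2l h_gt0) (leq_ltn_trans lo).
have i0I : (i0 <= (I x).+1)%N by rewrite iI.
by apply: le_trans (key i0 x i0_gt0 hi0 i0I); rewrite iI lerD2l.
Qed.

Lemma color_class_sum (H : sgraph) k (f : {ffun H -> 'I_k}) :
  (\sum_c #|color_class f c| = #|vertex H|)%N.
Proof.
rewrite -[RHS]sum1_card (partition_big f xpredT) //=; apply: eq_bigr => c _.
by rewrite -sum1_card; apply: eq_bigl => x; rewrite inE.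
Qed.

Theorem theorem4p1 (R : realType) (eta : R) (H : sgraph) (r : nat) :
  0 < eta ->
  (exists x y : H, adj x y) ->
  chromatic_number H = r ->
  let h : R := #|vertex H|%:R in
  let s : R := (sigma H)%:R in
  let omega : R := (h - s) / (r%:R - 1) in
  exists n0 : nat, forall (G : sgraph) (n : nat),
    #|vertex G| = n ->
    (n0 <= n)%N ->
    (forall i : nat, (1 <= i)%N -> i%:R <= omega * n%:R / h ->
       (1 - (omega + s) / h) * n%:R + s / omega * i%:R + eta * n%:R
         <= (nth_degree G i)%:R) ->
    exists T : {set {ffun H -> G}},
      is_tiling T /\ #|~: covered T|%:R <= eta * n%:R.
Proof.
move=> eta_gt0 [x [y xy]] rH h s omega.
have := edge_chromatic xy; have := sigma_attained (ltnW (edge_chromatic xy)).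
have sle f := @sigma_le H f; move: sle.
rewrite {}/omega rH => sle [f [c [pf fc]]] r_gt1.
case: r r_gt1 rH f c pf fc sle => [|[|k]] // _ rH f c pf fc sle.
have sg_gt0 : (0 < sigma H)%N by rewrite -fc; apply: class_gt0.
(* Each of the [k.+2] colour classes has at least [sigma H] vertices, so the neck is no larger than
   a wide part. *)
have ksg : (k.+1 * sigma H <= #|vertex H| - sigma H)%N.
  rewrite leq_subRL -?fc ?max_card // fc -mulSn -(color_class_sum f).
  rewrite -[k.+2 in leqLHS]card_ord -sum_nat_const.
  by apply: leq_sum => c' _; apply: sle.
(* The tiling lemmas are for surplus at most [1], and lowering [eta] only weakens the degree
   condition. *)
pose eta1 := Num.min eta 1.
have eta1_gt0 : 0 < eta1 by rewrite lt_min eta_gt0 ltr01.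
have eta1_le : eta1 <= eta by rewrite ge_min lexx.
have eta2_gt0 : 0 < eta1 / 2 by rewrite divr_gt0.
have eta2_le : eta1 / 2 <= 1.
  by rewrite ler_pdivrMr // (le_trans (_ : _ <= 1)) ?ge_min ?lexx ?orbT // mul1r ler1n.
have ks_gt0 : (0 < k.+1 * sigma H)%N by rewrite muln_gt0.
(* Bottles of level [1] are those that [bottles_copies] fills with copies of [H]. *)
have [n0 Hn0] := almost_tiling (ltn0Sn k) ks_gt0 ksg eta2_gt0 eta2_le (ltnSn 0) eta_gt0.
have [n1 Hn1] := eventually_ge 2 eta1_gt0.
exists (maxn (maxn n0 n1) (height k.+1 (k.+1 * sigma H) (#|vertex H| - sigma H))) => G n <-.
rewrite !geq_max => /andP[/andP[le0 le1] le2] deg.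
have [|I adm] := degree_seq_admissible (ltn0Sn k) sg_gt0 ksg eta1_gt0 le2 (Hn1 _ le1).
  move=> i i_gt0 le_i; apply: le_trans (deg i i_gt0 le_i).
  by rewrite lerD2l ler_wpM2r ?ler0n.
have [s1 t1 u1] := Hn0 _ _ _ adm le0.
have [|F [F1 F2]] := @bottles_copies H G k f c pf s1.
  by rewrite fc.
by exists F; split=> //; rewrite F2 setCK.
Qed.
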